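(* Every subgroup of a CI-group is a CI-group. Furthermore, every infinite CI-group $G$ satisfies: (1) $G$ is a torsion group (every element of $G$ has finite order); and (2) $G$ is not locally finite. In addition, if there exists an infinite CI-group, then there exists an infinite CI-group that is finitely generated.
   Context: For a (possibly infinite) group $G$ and a subset $S\subseteq G\setminus\{e\}$ with $S=S^{-1}$ ($S$ not necessarily finite or generating), the Cayley graph $\mathrm{Cay}(G;S)$ has vertex set $G$, with $g$ adjacent to $gs$ for all $g\in G$, $s\in S$. The graph $\mathrm{Cay}(G;S)$ is a CI-graph if whenever $S'\subseteq G\setminus\{e\}$, $S'=S'^{-1}$, and $\mathrm{Cay}(G;S)\cong\mathrm{Cay}(G;S')$ as graphs, there is a group automorphism $\alpha$ of $G$ with $\alpha(S)=S'$. A group $G$ is a CI-group if every Cayley graph $\mathrm{Cay}(G;S)$ on $G$ is a CI-graph. A group is locally finite if every finitely generated subgroup of it is finite. *)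

(* Defs.v *)
From HB Require Import structures.
From mathcomp Require Import all_boot.
From mathcomp Require Import boolp classical_sets functions cardinality.

Set Implicit Arguments.
Unset Strict Implicit.
Unset Printing Implicit Defensive.

Local Open Scope classical_set_scope.
Local Open Scope group_scope.

Definition graph_iso (V V' : Type) (E : V -> V -> Prop) (E' : V' -> V' -> Prop) :=
  exists2 f : V -> V', bijective f & forall x y, E x y <-> E' (f x) (f y).

Section GroupNotions.
Variable G : groupType.
Implicit Types (S A H : set G).

Definition connection_set S := ~ S 1 /\ [set s^-1 | s in S] = S.

Definition Cay S (g h : G) := exists2 s, S s & h = g * s.

Definition CI_graph S := forall S', connection_set S' ->
  graph_iso (Cay S) (Cay S') ->
  exists2 alpha : {multiplicative G -> G}, bijective alpha & alpha @` S = S'.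

Definition CI_group := forall S, connection_set S -> CI_graph S.

Definition torsion_group := forall g : G, exists2 n : nat, (0 < n)%N & g ^+ n = 1.

Definition is_subgroup H := group_closed [in H].

Definition generated_subgroup A : set G := smallest is_subgroup A.

Definition finitely_generated H :=
  exists2 A, finite_set A & generated_subgroup A = H.

Definition locally_finite := forall H,
  is_subgroup H -> finitely_generated H -> finite_set H.

Definition infinite_group := infinite_set [set: G].

End GroupNotions.

(* [subGroupType P] takes a boolean [P]; classically this is no restriction: every
   subset that is a subgroup carries such a structure. *)
Lemma subGroupType_of_is_subgroup (G : groupType) (H : set G) :
  is_subgroup H -> inhabited (subGroupType [in H]).
Proof.
move=> Hgrp.
pose mixin := SubChoice_isSubGroup.Build G [in H] {x : G | [in H] x} Hgrp.
pose K : subGroupType [in H] := HB.pack {x : G | [in H] x} mixin.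
exact: inhabits K.
Qed.

(* Main.v *)
Require Import Defs.
From HB Require Import structures.
From mathcomp Require Import all_boot all_algebra zify.
From mathcomp Require Import boolp classical_sets functions cardinality.

Set Implicit Arguments.
Unset Strict Implicit.
Unset Printing Implicit Defensive.

(** Every subgroup of a CI-group is a CI-group ([CI_subgroup]) because
    isomorphic Cayley graphs on a subgroup H extend, coset by coset, to
    isomorphic Cayley graphs on G, and the resulting automorphism of G
    restricts to H when the connection set generates H. Either the connection
    set or its complement generates H, and complementing changes nothing in the
    question.

    The assertions on infinite CI-groups hold because no infinite group is a
    CI-group ([infinite_group_not_CI]). By the first part it is enough to look
    at countable groups. The source of non-CI graphs is the random graph, which
    is up to isomorphism the only countable graph with the extension property
    ([extension_property_iso]). A greedy construction produces many connection
    sets whose Cayley graph is the random graph: one can force a given finite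
    configuration into the set, or keep a family of configurations out of it
    when generic choices do not create them. If the family is invariant under
    automorphisms, two such sets are not related by an automorphism
    ([avoidable_not_CI]).

    The quadruples x, y, xy, yx where x and y do not commute modulo the
    FC-centre can be avoided when the FC-centre is finite: a bad choice of the
    new vertex lies in a finite union of cosets of centralizers of infinite
    index, or in finitely many translated sets of square roots, and these do
    not cover the group, by B. H. Neumann's lemma and the pigeonhole principle
    ([sparse_cover_neq]). Hence the FC-centre of a countable infinite CI-group
    is infinite ([infinite_FC_center]), so there is an infinite abelian
    subgroup, which is again a CI-group ([CI_countable_abelian]).

    In an infinite abelian group with finite 2-torsion and 3-torsion, the
    pairs x, x^2 can be avoided, so an infinite abelian CI-group has infinite
    2-torsion or 3-torsion ([CI_infinite_torsion]) and contains elementary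
    abelian p-groups of any finite rank, for p = 2 or p = 3. But elementary
    abelian p-groups of large rank are not CI-groups ([pair_space_not_CI]):
    with n = 2p - 1, one takes pairs (d, b) where d is a vector of size n and
    b is indexed by the subsets of the n coordinates, and shifts b by the
    squarefree monomials in d. This nonlinear bijection carries one Cayley
    graph to another, because the binomial coefficients 'C(n - j, p - j) with
    0 < j < p vanish modulo p ([pairing_mono]), whereas a linear map cannot
    do it for reasons of degree ([pairing_not_linear]). *)

Local Open Scope classical_set_scope.
Local Open Scope group_scope.

(** * Group morphisms and generated subgroups *)

Section Morphisms.
Variables (M G : groupType) (f : M -> G).
Hypothesis fM : {morph f : x y / x * y}.

Lemma morph1 : f 1 = 1.
Proof. by apply: (mulgI (f 1)); rewrite -fM !mulg1. Qed.

Lemma morphV x : f x^-1 = (f x)^-1.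
Proof. by apply: (mulgI (f x)); rewrite -fM !mulgV morph1. Qed.

End Morphisms.

Section Generation.
Variable G : groupType.
Implicit Types (S H : set G) (x y : G).

Lemma is_subgroupP H :
  is_subgroup H <-> [/\ H 1, forall x, H x -> H x^-1
                         & forall x y, H x -> H y -> H (x * y)].
Proof.
split=> [Hgrp|[H1 HV HM]].
  have [H1 _] := Hgrp; split=> [|x Hx|x y Hx Hy].
  - exact: set_mem H1.
  - by apply: set_mem; apply: (group_closedV Hgrp); apply: mem_set.
  - by apply: set_mem; apply: (group_closedM Hgrp); apply: mem_set.
split; first exact: mem_set.
by move=> x y /set_mem Hx /set_mem Hy; apply: mem_set; apply/HM/HV.
Qed.

Lemma generated_subgroup_ind S H :
  H 1 -> (forall x, H x -> H x^-1) -> (forall x y, H x -> H y -> H (x * y)) ->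
  S `<=` H -> generated_subgroup S `<=` H.
Proof. by move=> H1 HV HM; apply: smallest_sub; apply/is_subgroupP. Qed.

Lemma generated_is_subgroup S :
  [/\ generated_subgroup S 1,
      forall x, generated_subgroup S x -> generated_subgroup S x^-1
    & forall x y, generated_subgroup S x -> generated_subgroup S y ->
        generated_subgroup S (x * y)].
Proof.
split=> [H [/is_subgroupP[]//]|x Sx H [Hgrp SH]|x y Sx Sy H [Hgrp SH]].
  by have [_ HV _] := (is_subgroupP H).1 Hgrp; apply: HV; apply: Sx.
by have [_ _ HM] := (is_subgroupP H).1 Hgrp; apply: HM; [apply: Sx|apply: Sy].
Qed.

Lemma connection_set_inv S : connection_set S -> forall x, S x -> S x^-1.
Proof. by move=> [_ SV] x Sx; rewrite -SV; exists x. Qed.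

Lemma connection_setP S :
  connection_set S <-> ~ S 1 /\ forall x, S x -> S x^-1.
Proof.
split=> [Sc|[S1 SV]]; first by split; [case: Sc | apply: connection_set_inv].
split=> //; apply/seteqP; split=> [_ [x Sx <-]|x Sx]; first exact: SV.
by exists x^-1; rewrite ?invgK //; apply: SV.
Qed.

Lemma CayP S x y : Cay S x y <-> S (x^-1 * y).
Proof.
split=> [[s Ss ->]|Sxy]; first by rewrite mulKg.
by exists (x^-1 * y); rewrite ?mulVKg.
Qed.

Definition complement S : set G := [set x | x <> 1 /\ ~ S x].

Lemma connection_set_complement S :
  connection_set S -> connection_set (complement S).
Proof.
move=> Sc; apply/connection_setP; split=> [[]//|x [x1 Sx]].
split=> [xV|/(connection_set_inv Sc)]; last by rewrite invgK.
by apply: x1; rewrite -[x]invgK xV invg1.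
Qed.

Lemma complementK S : ~ S 1 -> complement (complement S) = S.
Proof.
move=> S1; apply/seteqP; split=> x.
  by move=> [x1 Sx]; apply: contrapT => nSx; apply: Sx.
by move=> Sx; split=> [x1|[]//]; apply: S1; rewrite -x1.
Qed.

(** If x lies outside the subgroup generated by S, then so does every h * x with
    h in that subgroup, and h = (h * x) * x^-1 is a product of elements of the
    complement of S. *)
Lemma generated_or_complement S :
  generated_subgroup S = setT \/ generated_subgroup (complement S) = setT.
Proof.
have [[x Sx]|gen] := pselect (exists x, ~ generated_subgroup S x); last first.
  left; apply/seteqP; split=> // x _; apply: contrapT => nSx.
  by apply: gen; exists x.
right; have [S1 SV SM] := generated_is_subgroup S.
have [C1 CV CM] := generated_is_subgroup (complement S).
have out y : ~ generated_subgroup S y -> generated_subgroup (complement S) y.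
  move=> Sy; apply: sub_gen_smallest; split=> [y1|Sy'].
    by apply: Sy; rewrite y1.
  by apply: Sy; apply: sub_gen_smallest.
apply/seteqP; split=> // y _.
have [Sy|/out//] := pselect (generated_subgroup S y).
rewrite -(mulgK x y); apply: CM; last by apply: CV; apply: out.
apply: out => Syx; apply: Sx; rewrite -(mulKg y x); apply: SM => //; exact: SV.
Qed.

End Generation.

(** Distinct vertices are adjacent for the complement of S exactly when they are
    not adjacent for S. Passing to the complement lets one assume that the
    connection set generates the group. *)
Lemma graph_iso_complement (G : groupType) (S S' : set G) :
  graph_iso (Cay S) (Cay S') ->
  graph_iso (Cay (complement S)) (Cay (complement S')).
Proof.
move=> [phi phib phiE]; exists phi => // x y.
have xy1 (z t : G) : z^-1 * t <> 1 <-> z <> t.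
  split=> [zt1 zt|zt /(congr1 (fun w => z * w))].
    by apply: zt1; rewrite zt mulVg.
  by rewrite mulVKg mulg1 => /esym.
have := phiE x y; rewrite !CayP /complement /= !xy1 => E.
have eq_phi : x = y <-> phi x = phi y.
  by split=> [->//|]; apply: (bij_inj phib).
by rewrite E eq_phi.
Qed.

(** S generates the group exactly when its Cayley graph is connected, and
    connectedness is invariant under isomorphism. The set X below collects the
    vertices g for which the image of g can be reached from the image of 1. *)
Lemma iso_generated (G : groupType) (S S' : set G) :
  connection_set S -> connection_set S' ->
  graph_iso (Cay S) (Cay S') ->
  generated_subgroup S = setT -> generated_subgroup S' = setT.
Proof.
move=> Sc S'c [phi phib phiE] Sgen.
have [S1 SV SM] := generated_is_subgroup S'.
pose X := [set g | generated_subgroup S' ((phi 1)^-1 * phi g)].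
have XS g s : S s -> X g -> X (g * s).
  move=> Ss Xg; have /phiE/CayP S'gs : Cay S g (g * s) by exists s.
  rewrite /X /= -(mulVKg (phi g) (phi (g * s))) mulgA.
  by apply: SM => //; apply: sub_gen_smallest.
(* X need not be a subgroup, but its right stabilizer K is one *)
pose K := [set g | forall x, X x -> X (x * g) /\ X (x * g^-1)].
have KT g : K g.
  suff: generated_subgroup S `<=` K by rewrite Sgen; apply.
  apply: generated_subgroup_ind => [x Xx|h Kh x Xx|h k Kh Kk x Xx|s Ss x Xx].
  - by rewrite invg1 !mulg1.
  - by rewrite invgK; have [] := Kh x Xx.
  - rewrite invgM !mulgA; split.
      by case: (Kk _ (Kh _ Xx).1).
    by case: (Kh _ (Kk _ Xx).2).
  - by split; apply: XS => //; apply: connection_set_inv.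
have X1 : X 1 by rewrite /X /= mulVg.
have XT g : X g by have [+ _] := KT g 1 X1; rewrite mul1g.
have [psi _ psiK] := phib.
apply/seteqP; split=> // y _.
have := XT (psi (phi 1 * y)); by rewrite /X /= psiK mulKg.
Qed.

(** * The CI property passes to subgroups *)

Section Transport.
Variables (M G : groupType) (f : M -> G).
Hypothesis fM : {morph f : x y / x * y}.
Hypothesis f_inj : injective f.

Let fV := morphV fM.

(** The default value 1 does not depend on g, so the representative depends only
    on the left coset of g. *)
Definition coset_rep (g : G) : G := xget 1 [set h | exists m, g = h * f m].

Lemma coset_repP g : exists m, g = coset_rep g * f m.
Proof.
apply: (@xgetPex _ 1 [set h | exists m, g = h * f m]).
by exists g, 1; rewrite (morph1 fM) mulg1.
Qed.

Lemma coset_repM g m : coset_rep (g * f m) = coset_rep g.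
Proof.
rewrite /coset_rep; congr xget; apply/seteqP; split=> h [n e].
  by exists (n * m^-1); rewrite fM fV mulgA -e mulgK.
by exists (n * m); rewrite fM mulgA -e.
Qed.

Definition coset_pos (g : G) : M := projT1 (cid (coset_repP g)).

Lemma coset_posP g : g = coset_rep g * f (coset_pos g).
Proof. exact: projT2 (cid (coset_repP g)). Qed.

Lemma coset_posM g m : coset_pos (g * f m) = coset_pos g * m.
Proof.
apply: f_inj; apply: (mulgI (coset_rep g)); rewrite fM mulgA -coset_posP.
by rewrite -(coset_repM g m) -coset_posP.
Qed.

(** The graph Cay (f @` S) is a disjoint union of copies of Cay S, one on each
    left coset of the image of f; this map acts as phi in each copy. *)
Definition cosetwise (phi : M -> M) g := coset_rep g * f (phi (coset_pos g)).

Lemma cosetwise_rep phi g : coset_rep (cosetwise phi g) = coset_rep g.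
Proof. by rewrite coset_repM [in RHS](coset_posP g) coset_repM. Qed.

Lemma cosetwise_pos phi g : coset_pos (cosetwise phi g) = phi (coset_pos g).
Proof.
apply: f_inj; apply: (mulgI (coset_rep g)).
by rewrite -{1}(cosetwise_rep phi) -coset_posP.
Qed.

Lemma cosetwiseK phi psi :
  cancel phi psi -> cancel (cosetwise phi) (cosetwise psi).
Proof.
move=> phiK g.
by rewrite {1}/cosetwise cosetwise_rep cosetwise_pos phiK -coset_posP.
Qed.

Lemma Cay_cosetE S g h : Cay (f @` S) g h <->
  coset_rep g = coset_rep h /\ Cay S (coset_pos g) (coset_pos h).
Proof.
split=> [[_ [s Ss <-] ->]|[e [s Ss es]]].
  by rewrite coset_repM coset_posM; split=> //; exists s.
exists (f s); first by exists s.
by rewrite [LHS]coset_posP es fM mulgA -e -coset_posP.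
Qed.

Lemma graph_iso_embed S S' :
  graph_iso (Cay S) (Cay S') -> graph_iso (Cay (f @` S)) (Cay (f @` S')).
Proof.
move=> [phi [psi phiK psiK] phiE]; exists (cosetwise phi).
  by exists (cosetwise psi); apply: cosetwiseK.
move=> g h; rewrite !Cay_cosetE !cosetwise_rep !cosetwise_pos.
by split=> -[e]; rewrite phiE.
Qed.

Lemma connection_set_embed S : connection_set S -> connection_set (f @` S).
Proof.
move=> Sc; apply/connection_setP; split.
  by move=> [x Sx]; rewrite -(morph1 fM) => /f_inj x1; case: Sc; rewrite -x1.
by move=> _ [x Sx <-]; exists x^-1; rewrite ?fV //; apply: connection_set_inv.
Qed.

(** An automorphism sending f @` S into f @` S' maps the image of f into itself,
    hence restricts to M, as soon as S generates M. *)
Lemma generating_set_image (alpha : G -> G) S S' :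
    {morph alpha : x y / x * y} -> generated_subgroup S = setT ->
    alpha @` (f @` S) `<=` f @` S' ->
  forall m, exists n, alpha (f m) = f n.
Proof.
move=> alphaM Sgen SS' m.
suff: generated_subgroup S `<=` [set m | exists n, alpha (f m) = f n].
  by rewrite Sgen; apply.
apply: generated_subgroup_ind => /= [|x [n en]|x y [n en] [k ek]|x Sx].
- by exists 1; rewrite !(morph1 fM) (morph1 alphaM).
- by exists n^-1; rewrite !fV (morphV alphaM) en.
- by exists (n * k); rewrite !fM alphaM en ek.
- have [|n _ en] := SS' (alpha (f x)); last by exists n.
  by exists (f x) => //; exists x.
Qed.

Lemma CI_graph_embed S : CI_graph (f @` S) -> connection_set S ->
  generated_subgroup S = setT -> CI_graph S.
Proof.
move=> CIfS Sc Sgen S' S'c SS'.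
have S'gen := iso_generated Sc S'c SS' Sgen.
have [alpha [beta alphaK betaK] aS] :=
  CIfS _ (connection_set_embed S'c) (graph_iso_embed SS').
have betaM : {morph beta : x y / x * y} by exact: can2_gmulfM alphaK betaK.
have sub_aS : alpha @` (f @` S) `<=` f @` S' by rewrite aS.
have sub_bS : beta @` (f @` S') `<=` f @` S.
  by rewrite -aS => _ [_ [x Sx <-] <-]; rewrite alphaK.
have /choice[a aE] := generating_set_image (@gmulfM _ _ alpha) Sgen sub_aS.
have /choice[b bE] := generating_set_image betaM S'gen sub_bS.
have aM : {morph a : x y / x * y}.
  by move=> x y; apply: f_inj; rewrite -aE !fM -!aE gmulfM.
have aK : cancel a b by move=> x; apply: f_inj; rewrite -bE -aE alphaK.
have bK : cancel b a by move=> x; apply: f_inj; rewrite -aE -bE betaK.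
pose mix := isMultiplicative.Build M M a aM.
pose A : {multiplicative M -> M} := HB.pack a mix.
exists A; first by exists b.
apply/seteqP; split=> [_ [x Sx <-]|y S'y].
  have [|y S'y] := sub_aS (alpha (f x)); first by exists (f x) => //; exists x.
  by rewrite aE => /f_inj yax; move: S'y; rewrite yax.
exists (b y); last exact: bK.
have [|x Sx xE] := sub_bS (beta (f y)); first by exists (f y) => //; exists y.
by move: Sx; rewrite bE in xE; rewrite (f_inj xE).
Qed.

End Transport.

Lemma CI_graph_complement (G : groupType) (S : set G) : connection_set S ->
  CI_graph (complement S) -> CI_graph S.
Proof.
move=> Sc CIS S' S'c /graph_iso_complement SS'.
have [alpha alphab aS] := CIS _ (connection_set_complement S'c) SS'.
exists alpha => //; have [beta alphaK betaK] := alphab.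
have alpha1 := morph1 (@gmulfM _ _ alpha).
rewrite -[S'](complementK (proj1 S'c)) -aS.
apply/seteqP; split=> [_ [x Sx <-]|y [y1 Sy]].
  split=> [|[y [y1 Sy] /(bij_inj alphab) yx]]; last by apply: Sy; rewrite yx.
  by rewrite -alpha1 => /(bij_inj alphab) x1; case: Sc; rewrite -x1.
exists (beta y) => //; apply: contrapT => Sby; apply: Sy; exists (beta y) => //.
by split=> // by1; apply: y1; rewrite -(betaK y) by1.
Qed.

(** Isomorphic Cayley graphs on M extend coset by coset to isomorphic Cayley
    graphs on G. The automorphism of G obtained from the CI property restricts
    to M when the connection set generates M, and otherwise its complement
    does. *)
Theorem CI_embed (M G : groupType) (f : M -> G) :
  {morph f : x y / x * y} -> injective f -> CI_group G -> CI_group M.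
Proof.
move=> fM f_inj CIG S Sc.
have CIgen (T : set M) : connection_set T -> generated_subgroup T = setT ->
    CI_graph T.
  move=> Tc; apply: (CI_graph_embed fM f_inj) => //.
  by apply: CIG; apply: connection_set_embed.
have [|gen] := generated_or_complement S; first exact: CIgen.
apply: (@CI_graph_complement _ S) => //; apply: CIgen => //.
exact: connection_set_complement.
Qed.

Theorem CI_subgroup (G : groupType) (P : pred G) (H : subGroupType P) :
  CI_group G -> CI_group H.
Proof. exact: CI_embed (@valM _ _ H) val_inj. Qed.

(** * Cayley graphs isomorphic to the random graph *)

Lemma iterated_choice (T : Type) (I : T -> Prop) (R : nat -> T -> T -> Prop)
    t0 :
  I t0 -> (forall n t, I t -> exists2 t', I t' & R n t t') ->
  exists2 t : nat -> T, t 0%N = t0 & forall n, I (t n) /\ R n (t n) (t n.+1).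
Proof.
move=> It0 step.
have /choice[next nextP] : forall p : nat * {t | I t},
    exists t' : {t | I t}, R p.1 (sval p.2) (sval t').
  move=> [n [t It]]; have [t' It' Rt'] := step n t It.
  by exists (exist _ t' It').
pose fix seqt n := if n is m.+1 then next (m, seqt m) else exist I t0 It0.
exists (fun n => sval (seqt n)) => // n; split; first exact: svalP.
exact: nextP (n, seqt n).
Qed.

(** The defining property of the random graph. *)
Definition extension_property (V : eqType) (E : V -> V -> Prop) :=
  forall U W : seq V, {in U, forall u, u \notin W} ->
  exists z, [/\ z \notin U ++ W, {in U, forall u, E u z}
              & {in W, forall w, ~ E w z}].

Section BackAndForth.

(** The bijection between the two projections of p is expressed on pairs of
    elements of p, together with the invariance of adjacency, so that swapping
    the coordinates of p exchanges the two graphs. *)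
Definition partial_iso (V V' : eqType) (E : V -> V -> Prop)
    (E' : V' -> V' -> Prop) (p : seq (V * V')) :=
  {in p &, forall a b, (a.1 = b.1 <-> a.2 = b.2) /\
                       (E a.1 b.1 <-> E' a.2 b.2)}.

Lemma partial_iso_swap (V V' : eqType) (E : V -> V -> Prop)
    (E' : V' -> V' -> Prop) p :
  partial_iso E E' p -> partial_iso E' E [seq (a.2, a.1) | a <- p].
Proof.
move=> pP _ _ /mapP[a ap ->] /mapP[b bp ->] /=.
by have [e1 e2] := pP a b ap bp; split; apply: iff_sym.
Qed.

Lemma partial_iso_extend (V V' : eqType) (E : V -> V -> Prop)
    (E' : V' -> V' -> Prop) :
    (forall x y, E x y -> E y x) -> (forall x, ~ E x x) ->
    (forall x y, E' x y -> E' y x) -> (forall x, ~ E' x x) ->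
    extension_property E' ->
  forall p x, partial_iso E E' p -> exists y, partial_iso E E' ((x, y) :: p).
Proof.
move=> Esym Eirr E'sym E'irr E'ext p x pP.
have [/mapP[[x' y] /= xyp ->{x}]|xp] := boolP (x \in map fst p).
  exists y => a b; rewrite !inE.
  by move=> /predU1P[->|ap] /predU1P[->|bp]; apply: pP.
pose U := [seq a.2 | a <- p & `[< E a.1 x >]].
pose W := [seq a.2 | a <- p & ~~ `[< E a.1 x >]].
have [|y [yUW yU yW]] := E'ext U W.
  move=> _ /mapP[a + ->]; rewrite mem_filter => /andP[/asboolP Eax ap].
  apply/mapP => -[b]; rewrite mem_filter => /andP[/asboolP Ebx bp ab].
  by apply: Ebx; rewrite -((pP a b ap bp).1.2 ab).
have new a : a \in p -> [/\ a.1 <> x, a.2 <> y & E a.1 x <-> E' a.2 y].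
  move=> ap; split.
  - by move=> ax; case/negP: xp; rewrite -ax; apply: map_f.
  - move=> ay; case/negP: yUW; rewrite mem_cat -ay.
    by case: (boolP `[< E a.1 x >]) => Eax; apply/orP; [left|right];
      apply/mapP; exists a => //; rewrite mem_filter Eax.
  - split=> [Eax|E'ay].
      by apply: yU; apply/mapP; exists a => //; rewrite mem_filter asboolT.
    apply: contrapT => Eax; apply: (yW a.2) => //.
    by apply/mapP; exists a => //; rewrite mem_filter asboolF.
exists y => a b; rewrite !inE => /predU1P[->|ap] /predU1P[->|bp] /=.
- by split=> //; split=> [/Eirr|/E'irr].
- have [bx by_ E_E'] := new b bp; split.
    by split=> /esym.
  by split=> [/Esym/E_E'/E'sym|/E'sym/E_E'/Esym].
- have [ax ay E_E'] := new a ap; split=> //.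
- exact: pP.
Qed.

(** Back and forth: two countable graphs with the extension property are
    isomorphic. A finite partial isomorphism is extended to the n-th vertices of
    both graphs at step n, and the union of all stages is a bijection. *)
Theorem extension_property_iso (V V' : eqType) (E : V -> V -> Prop)
    (E' : V' -> V' -> Prop) (e : nat -> V) (e' : nat -> V') :
    (forall x, exists n, e n = x) -> (forall x, exists n, e' n = x) ->
    (forall x y, E x y -> E y x) -> (forall x, ~ E x x) ->
    (forall x y, E' x y -> E' y x) -> (forall x, ~ E' x x) ->
    extension_property E -> extension_property E' -> graph_iso E E'.
Proof.
move=> esurj e'surj Esym Eirr E'sym E'irr Eext E'ext.
pose R n (p p' : seq (V * V')) := [/\ {subset p <= p'},
                     exists y, (e n, y) \in p'
                   & exists x, (x, e' n) \in p'].
have [||t _ tP] := @iterated_choice _ (@partial_iso V V' E E') R [::].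
- by move=> a b; rewrite in_nil.
- move=> n p pP.
  have [y yP] := partial_iso_extend Esym Eirr E'sym E'irr E'ext (e n) pP.
  have [x xP] := partial_iso_extend E'sym E'irr Esym Eirr Eext (e' n)
    (partial_iso_swap yP).
  exists ((x, e' n) :: (e n, y) :: p).
    have := partial_iso_swap xP; rewrite /= -map_comp.
    by rewrite (eq_map (g := id)) ?map_id // => -[].
  split=> [a ap||]; first by rewrite !inE ap !orbT.
    by exists y; rewrite !inE eqxx !orbT.
  by exists x; rewrite !inE eqxx.
have mono m n : (m <= n)%N -> {subset t m <= t n}.
  elim: n => [|n IHn]; first by rewrite leqn0 => /eqP->.
  rewrite leq_eqVlt => /predU1P[->//|/IHn mn] a /mn.
  by have [_ [+ _ _]] := tP n; apply.
have coh m n a b : a \in t m -> b \in t n ->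
    (a.1 = b.1 <-> a.2 = b.2) /\ (E a.1 b.1 <-> E' a.2 b.2).
  move=> am bn; have [iso _] := tP (maxn m n).
  by apply: iso; [apply: (mono m)|apply: (mono n)];
    rewrite ?leq_maxl ?leq_maxr.
have /choice[f fP] x : exists y, exists n, (x, y) \in t n.
  by have [n <-] := esurj x; have [_ [_ [y yn] _]] := tP n; exists y, n.+1.
have /choice[g gP] y : exists x, exists n, (x, y) \in t n.
  by have [n <-] := e'surj y; have [_ [_ _ [x xn]]] := tP n; exists x, n.+1.
exists f.
  exists g => [x|y].
    have [m xm] := fP x; have [n yn] := gP (f x).
    exact: ((coh _ _ _ _ yn xm).1.2 erefl).
  have [n yn] := gP y; have [m xm] := fP (g y).
  exact: ((coh _ _ _ _ xm yn).1.1 erefl).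
move=> x y; have [m xm] := fP x; have [n yn] := fP y.
exact: (coh _ _ _ _ xm yn).2.
Qed.

End BackAndForth.

Section GenericSets.
Variable G : groupType.
Implicit Types (F : seq G -> Prop) (T D U W q : seq G).

Definition inv_closed T := {in T, forall x, x^-1 \in T}.

(** What a connection set must contain for z to be adjacent to all of U. *)
Definition star (z : G) U := [seq z^-1 * u | u <- U] ++ [seq u^-1 * z | u <- U].

(** F is a family of forbidden finite configurations. *)
Definition avoids F T := forall q, F q -> ~ {subset q <= T}.

(** This is what one stage of a greedy construction of a connection set needs.
    The elements of T have been put in the set, those of D are decided, and z is
    to become adjacent to every vertex of U and to no vertex of W. The second
    condition is there because putting z^-1 * u in the set also puts its inverse
    in it. *)
Definition avoidable F := forall T D U W,
  inv_closed T -> avoids F T -> {in U, forall u, u \notin W} ->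
  exists z, [/\ {in U ++ W, forall u, z^-1 * u \notin D},
    {in U & W, forall u w, z^-1 * u <> w^-1 * z} & avoids F (T ++ star z U)].

Lemma inv_closed_cat T T' :
  inv_closed T -> inv_closed T' -> inv_closed (T ++ T').
Proof.
move=> TV T'V x; rewrite !mem_cat => /orP[/TV->//|/T'V->].
by rewrite orbT.
Qed.

Lemma inv_closed_star z U : inv_closed (star z U).
Proof.
move=> x; rewrite !mem_cat => /orP[] /mapP[u uU ->]; apply/orP.
  by right; apply/mapP; exists u; rewrite // invgM invgK.
by left; apply/mapP; exists u; rewrite // invgM invgK.
Qed.

(** The pairs (U, W) of finite sets of vertices are enumerated, and a vertex z
    that serves the n-th pair is chosen at stage n. A stage is a pair (T, D) as
    in [avoidable]; an element in D and outside T stays outside forever. *)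
Lemma extension_connection_set F T0 (e : nat -> G) :
    (forall x, exists n, e n = x) -> avoidable F ->
    inv_closed T0 -> 1 \notin T0 -> avoids F T0 ->
  exists S : set G, [/\ connection_set S, {in T0, forall x, S x},
    forall q, F q -> ~ {in q, forall x, S x} & extension_property (Cay S)].
Proof.
move=> esurj Fav T0V T01 T0F.
pose I (s : seq G * seq G) := [/\ inv_closed s.1, inv_closed s.2,
  {subset s.1 <= s.2}, (1 \in s.2) /\ (1 \notin s.1) & avoids F s.1].
pose R n (s s' : seq G * seq G) :=
  [/\ {subset s.1 <= s'.1}, {subset s.2 <= s'.2},
      {in s'.1, forall x, x \in s.2 -> x \in s.1}
    & forall us ws, unpickle n = Some (us, ws) ->
        let U := map e us in let W := map e ws in
        {in U, forall u, u \notin W} ->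
      exists z, [/\ {in U ++ W, forall u, z^-1 * u != 1},
        {in U, forall u, z^-1 * u \in s'.1}
      & {in W, forall w, z^-1 * w \in s'.2 /\ z^-1 * w \notin s'.1}]].
have skip n s : I s -> (forall us ws, unpickle n = Some (us, ws) ->
    ~ {in map e us, forall u, u \notin map e ws}) ->
    exists2 s', I s' & R n s s'.
  move=> Is no; exists s => //; split=> // us ws n_uw U W disj.
  by have := no us ws n_uw disj.
have [||t t0 tP] := @iterated_choice _ I R (T0, 1 :: T0).
- split=> //=; last by rewrite mem_head.
    move=> x; rewrite !inE => /predU1P[->|/T0V->]; last by rewrite orbT.
    by rewrite invg1 eqxx.
  by move=> x xT; rewrite inE xT orbT.
- move=> n [T D] IT; have [TV DV TD [D1 T1] TF] := IT.
  case n_uw: (@unpickle (seq nat * seq nat)%type n) => [[us ws]|]; last first.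
    by apply: skip => // us ws; rewrite n_uw.
  set U := map e us; set W := map e ws.
  have [disj|ndisj] := pselect {in U, forall u, u \notin W}; last first.
    by apply: skip => // us' ws'; rewrite n_uw => -[<- <-].
  have [z [zD zUW zF]] := Fav T D U W TV TF disj.
  have UD u : u \in U -> z^-1 * u \notin D.
    by move=> uU; apply: zD; rewrite mem_cat uU.
  have starD x : x \in star z U -> x \notin D.
    rewrite mem_cat => /orP[] /mapP[u uU ->]; first exact: UD.
    by apply: contra (UD u uU) => /DV; rewrite invgM invgK.
  exists (T ++ star z U, D ++ star z U ++ star z W).
    split=> //=.
    + by apply: inv_closed_cat => //; apply: inv_closed_star.
    + by do 2?apply: inv_closed_cat => //; apply: inv_closed_star.
    + move=> x; rewrite !mem_cat => /orP[/TD->//|->].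
      by rewrite orbT.
    + rewrite !mem_cat D1; split=> //; rewrite negb_or T1 /= -mem_cat.
      by apply/negP => /starD; rewrite D1.
  split=> /=.
  + by move=> x xT; rewrite mem_cat xT.
  + by move=> x xD; rewrite mem_cat xD.
  + by move=> x; rewrite mem_cat => /orP[//|/starD/negPf->].
  move=> us' ws'; rewrite n_uw => -[<- <-] /= _; exists z; split.
  + by move=> u /zD; apply: contra => /eqP->.
  + by move=> u uU; rewrite !mem_cat map_f ?orbT.
  + move=> w wW; rewrite !mem_cat !negb_or.
    rewrite [in X in X /\ _](map_f (fun w => z^-1 * w) wW) !orbT; split=> //.
    have wD : z^-1 * w \notin D by apply: zD; rewrite mem_cat wW orbT.
    apply/and3P; split.
    * by apply: contra wD => /TD.
    * apply/mapP => -[u uU] /mulgI wu; move: wW; rewrite wu.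
      by apply/negP; apply: disj.
    * apply/mapP => -[u uU] wu; apply: (zUW u w uU wW).
      by apply: invg_inj; rewrite !invgM !invgK wu.
have mono m n : (m <= n)%N -> [/\ {subset (t m).1 <= (t n).1},
    {subset (t m).2 <= (t n).2}
    & {in (t n).1, forall x, x \in (t m).2 -> x \in (t m).1}].
  elim: n => [|n IHn]; first by rewrite leqn0 => /eqP->; split.
  rewrite leq_eqVlt => /predU1P[->|/IHn[mn1 mn2 mn3]]; first by split.
  have [_ [n1 n2 n3 _]] := tP n; split=> x.
  - by move/mn1/n1.
  - by move/mn2/n2.
  - by move=> xn xm; apply: mn3 => //; apply: n3 => //; apply: mn2.
pose S := [set x | exists n, x \in (t n).1].
have Sc : connection_set S.
  apply/connection_setP; split=> [[n]|x [n xn]].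
    by have [[_ _ _ [_ /negP]]] := tP n.
  by exists n; have [[+ _ _ _ _] _] := tP n; apply.
exists S; split=> //.
- by move=> x xT0; exists 0%N; rewrite t0.
- move=> q Fq qS.
  have [n qn] : exists n, {subset q <= (t n).1}.
    elim: q qS {Fq} => [|x q IHq] qS; first by exists 0%N => x; rewrite in_nil.
    have [n qn] : exists n, {subset q <= (t n).1}.
      by apply: IHq => y yq; apply: qS; rewrite inE yq orbT.
    have [m xm] := qS x (mem_head _ _); exists (maxn m n) => y.
    rewrite inE => /predU1P[->|/qn].
      by have [+ _ _] := mono _ _ (leq_maxl m n); apply.
    by have [+ _ _] := mono _ _ (leq_maxr m n); apply.
  by have [[_ _ _ _ nF] _] := tP n; apply: nF qn.
move=> U W disj.
have /choice[d dP] : forall x, exists n, e n = x by [].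
have mapd (X : seq G) : map e (map d X) = X.
  by rewrite -map_comp -[RHS]map_id; apply: eq_map => x /=.
have [_ [_ _ _ /(_ (map d U) (map d W))]] := tP (pickle (map d U, map d W)).
rewrite pickleK !mapd => /(_ erefl disj)[z [zUW zU zW]]; exists z; split.
- by apply/negP => /zUW; rewrite mulVg eqxx.
- move=> u uU; apply/CayP; rewrite -[u^-1 * z]invgK.
  apply: connection_set_inv => //.
  by rewrite invgM invgK; eexists; apply: zU.
- move=> w wW /CayP/(connection_set_inv Sc); rewrite invgM invgK => -[n wn].
  have [wD wT] := zW w wW; set k := _.+1 in wD wT.
  case/negP: wT; have [m1 _ _] := mono _ _ (leq_maxl n k).
  by have [_ _ m3] := mono _ _ (leq_maxr n k); apply: m3 => //; apply: m1.
Qed.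

Lemma inv_closed_cat_star T z U : inv_closed T -> inv_closed (T ++ star z U).
Proof. by move=> TV; apply: inv_closed_cat => //; apply: inv_closed_star. Qed.

Lemma mem_cat_starP T z U x : x \in T ++ star z U -> [\/ x \in T,
  exists2 u, u \in U & x = z^-1 * u | exists2 u, u \in U & x = u^-1 * z].
Proof.
rewrite !mem_cat => /or3P[xT|/mapP[u uU ->]|/mapP[u uU ->]].
- exact: Or31.
- by apply: Or32; exists u.
- by apply: Or33; exists u.
Qed.

End GenericSets.

(** If F can be avoided, the greedy construction gives two connection sets with
    the extension property, one containing a member q of F and the other
    containing no member of F. Their Cayley graphs are isomorphic to the random
    graph, but no automorphism relates them since F is invariant under
    automorphisms. *)
Theorem avoidable_not_CI (G : groupType) (F : seq G -> Prop) (e : nat -> G) q :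
    (forall x, exists n, e n = x) ->
    (forall alpha : {multiplicative G -> G}, bijective alpha ->
       forall q, F q -> F (map alpha q)) ->
    avoidable F -> avoids F [::] -> F q -> 1 \notin q -> ~ CI_group G.
Proof.
move=> esurj Finv Fav F0 Fq q1 CIG.
have F'av : avoidable (fun _ : seq G => False).
  move=> T D U W _ _ disj.
  have [//|z [zD zUW _]] := Fav [::] D U W _ F0 disj.
  by exists z; split.
pose q' := q ++ [seq x^-1 | x <- q].
have q'V : inv_closed q'.
  move=> x; rewrite !mem_cat => /orP[xq|/mapP[y yq ->]].
    by rewrite map_f ?orbT.
  by rewrite invgK yq.
have q'1 : 1 \notin q'.
  rewrite mem_cat negb_or q1; apply/mapP => -[y yq /esym/eqP].
  by rewrite invg_eq1 => /eqP y1; rewrite y1 (negPf q1) in yq.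
have [|S [Sc qS _ Sext]] := extension_connection_set esurj F'av q'V q'1.
  by [].
have [//|//|S' [S'c _ S'F S'ext]] :=
  extension_connection_set esurj Fav _ _ F0.
have Csym (X : set G) : connection_set X -> forall x y, Cay X x y -> Cay X y x.
  move=> Xc x y /CayP/(connection_set_inv Xc); rewrite invgM invgK.
  by move/CayP.
have Cirr (X : set G) : connection_set X -> forall x, ~ Cay X x x.
  by move=> [X1 _] x /CayP; rewrite mulVg.
have SS' : graph_iso (Cay S) (Cay S').
  apply: (extension_property_iso esurj esurj) => //;
    by [apply: Csym | apply: Cirr].
have [alpha alphab aS] := CIG _ Sc _ S'c SS'.
apply: (S'F (map alpha q)); first exact: Finv.
move=> _ /mapP[x xq ->]; rewrite -aS; exists x => //.
by apply: qS; rewrite mem_cat xq.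
Qed.

(** * The FC-centre and coverings by cosets *)

Lemma infinite_set_notin (T : eqType) (A : set T) (s : seq T) :
  infinite_set A -> exists2 a, A a & a \notin s.
Proof.
move=> Ainf; apply: contrapT => no; apply: Ainf.
apply: (sub_finite_set _ (finite_seq s)) => a Aa /=.
by apply: contrapT => /negP ?; apply: no; exists a.
Qed.

Section FCCenter.
Variable G : groupType.
Implicit Types a b c g h x y z : G.

(** The FC-centre: the elements with finitely many conjugates. *)
Definition FC_center : set G := [set a | finite_set (range (conjg a))].

Lemma FC_conj_sub a (A : set G) : finite_set A -> (forall g, A (a ^ g)) ->
  FC_center a.
Proof. by move=> Afin aA; apply: sub_finite_set Afin => _ [g _ <-]. Qed.

Lemma FC_center1 : FC_center 1.
Proof.
by apply: (FC_conj_sub (finite_set1 (1 : G))) => g; rewrite conj1g.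
Qed.

Lemma FC_centerM a b : FC_center a -> FC_center b -> FC_center (a * b).
Proof.
move=> aF bF; apply: (FC_conj_sub (finite_image11 (fun x y => x * y) aF bF)).
by move=> g; exists g; rewrite ?conjMg.
Qed.

Lemma FC_centerV a : FC_center a -> FC_center a^-1.
Proof.
move=> aF; apply: (FC_conj_sub (finite_image (fun x => x^-1) aF)) => g.
by exists (a ^ g); [exists g|rewrite conjVg].
Qed.

Lemma FC_centerJ a h : FC_center a -> FC_center (a ^ h).
Proof.
move=> aF; apply: (FC_conj_sub aF) => g.
by exists (h * g) => //; rewrite conjgM.
Qed.

Lemma FC_center_conj a h : FC_center (a ^ h) <-> FC_center a.
Proof.
by split=> [/(@FC_centerJ _ h^-1)|]; [rewrite conjgK|apply: FC_centerJ].
Qed.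

Lemma FC_center_comm x y : FC_center x \/ FC_center y ->
  FC_center ((x * y) * (y * x)^-1).
Proof.
rewrite invgM !mulgA => -[xF|yF].
  rewrite -!mulgA; apply: FC_centerM => //.
  by have := FC_centerJ y^-1 (FC_centerV xF); rewrite conjgE invgK.
apply: FC_centerM; last exact: FC_centerV.
by have := FC_centerJ x^-1 yF; rewrite conjgE invgK mulgA.
Qed.

Lemma FC_centerC x y : FC_center (x * y) -> FC_center (y * x).
Proof. by move=> /(@FC_centerJ _ x); rewrite conjgE !gnorm. Qed.

Lemma FC_center_comm_prod x y : FC_center (x * y) ->
  FC_center ((x * y) * (y * x)^-1).
Proof. by move=> xyF; apply: FC_centerM => //; apply/FC_centerV/FC_centerC. Qed.

Lemma FC_center_aut (alpha : G -> G) a : bijective alpha ->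
  {morph alpha : x y / x * y} -> FC_center (alpha a) -> FC_center a.
Proof.
move=> [beta alphaK betaK] alphaM aF.
apply: (FC_conj_sub (finite_image beta aF)) => g; exists (alpha a ^ alpha g).
  by exists (alpha g).
by rewrite !conjgE -(morphV alphaM) -!alphaM alphaK.
Qed.

(** B. H. Neumann's lemma for centralizers: a group is not a finite union of
    cosets of subgroups of infinite index. By induction on the list of
    subgroups: some coset of the first one, C(c), is not among the given cosets,
    so it is covered by cosets of the other ones. Translating this covering
    covers all the given cosets of C(c), which gets rid of C(c). *)
Lemma coset_cover_neq (cs xs : seq G) : {in cs, forall c, ~ FC_center c} ->
  exists z, {in xs & cs, forall x c, ~ commute c (x^-1 * z)}.
Proof.
elim: cs xs => [|c cs IHcs] xs csF; first by exists 1.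
apply: contrapT => no.
have cover z : exists x c',
    [/\ x \in xs, c' \in c :: cs & commute c' (x^-1 * z)].
  apply: contrapT => noz; apply: no; exists z => x c' xxs c'cs xc'.
  by apply: noz; exists x, c'.
have cF : ~ FC_center c by apply: csF; rewrite mem_head.
have [_ [g _ <-] gxs] := infinite_set_notin [seq c ^ x^-1 | x <- xs] cF.
have gc x : x \in xs -> ~ commute c (x^-1 * g^-1).
  move=> xxs /commgP/conjg_fixP xg; case/negP: gxs; apply/mapP; exists x => //.
  by rewrite -{1}xg -conjgM mulgVK.
have coset k : commute c k ->
    exists x c', [/\ x \in xs, c' \in cs & commute c' (x^-1 * (g^-1 * k))].
  move=> ck; have [x [c' [xxs]]] := cover (g^-1 * k).
  rewrite inE => /predU1P[->|c'cs xc']; last by exists x, c'.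
  move=> xk; case: (gc x xxs); rewrite -(mulgK k (x^-1 * g^-1)) -mulgA mulgA.
  by rewrite -[_ * k]mulgA; apply: commuteM => //; apply: commuteV.
have [|z zP] := IHcs (xs ++ [seq x * g * x' | x <- xs, x' <- xs]).
  by move=> c' c'cs; apply: csF; rewrite inE c'cs orbT.
have [x [c' [xxs]]] := cover z.
rewrite inE => /predU1P[->|c'cs xc']; last first.
  by apply: (zP x c') => //; rewrite mem_cat xxs.
move=> /coset[x' [c'' [x'xs c''cs]]].
have -> : x'^-1 * (g^-1 * (x^-1 * z)) = (x * g * x')^-1 * z.
  by rewrite !invgM !mulgA.
by apply: zP => //; rewrite mem_cat; apply/orP; right; apply: allpairs_f.
Qed.

(** Contained in a finite union of cosets of centralizers of elements outside
    the FC-centre, such a centralizer having infinite index. *)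
Definition thin (X : set G) := exists L : seq (G * G),
  {in L, forall p, ~ FC_center p.2} /\
  forall z, X z -> exists2 p, p \in L & commute p.2 (p.1^-1 * z).

Lemma thin_ex (X : set G) : thin X -> exists z, ~ X z.
Proof.
move=> [L [LF XL]].
have [_ /mapP[p pL ->]|z zP] := @coset_cover_neq (map snd L) (map fst L).
  exact: LF.
by exists z => /XL[p pL]; apply: zP; apply: map_f.
Qed.

Lemma thin_coset (X : set G) c : ~ FC_center c ->
  (forall z z', X z -> X z' -> commute c (z'^-1 * z)) -> thin X.
Proof.
move=> cF Xc; have [[z' Xz']|noX] := pselect (exists z, X z); last first.
  by exists [::]; split=> // z Xz; case: noX; exists z.
exists [:: (z', c)]; split=> [p|z Xz]; first by rewrite inE => /eqP->.
by exists (z', c); rewrite ?mem_head //; apply: Xc.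
Qed.

Lemma thin_shift (X : set G) g : thin X -> thin [set z | X (z * g)].
Proof.
move=> [L [LF XL]]; exists [seq (p.1 * g^-1, p.2 ^ g^-1) | p <- L].
split=> [_ /mapP[p pL ->]|z /XL[p pL pz]] /=.
  by rewrite FC_center_conj; apply: LF.
exists (p.1 * g^-1, p.2 ^ g^-1) => /=; first by apply/mapP; exists p.
have := congr1 (fun t => g * t * g^-1) pz.
by rewrite /commute !conjgE !invgM !invgK !mulgA mulgK mulgVK.
Qed.

Lemma thin_seq (I : eqType) (s : seq I) (X : I -> set G) :
  {in s, forall i, thin (X i)} -> thin [set z | exists2 i, i \in s & X i z].
Proof.
elim: s => [|i s IHs] sX; first by exists [::]; split=> // z [].
have [L [LF XL]] := sX i (mem_head _ _).
have [|L' [L'F XL']] := IHs.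
  by move=> j js; apply: sX; rewrite inE js orbT.
exists (L ++ L'); split=> [p|z [j]].
  by rewrite mem_cat => /orP[/LF|/L'F].
rewrite inE => /predU1P[->/XL[p pL]|js Xj].
  by exists p => //; rewrite mem_cat pL.
have [|p pL' pz] := XL' z; first by exists j.
by exists p => //; rewrite mem_cat pL' orbT.
Qed.

(** A relaxation of [thin] that finite sets and sets of square roots
    satisfy. *)
Definition sparse (X : set G) :=
  forall w, ~ FC_center w -> thin [set z | X z /\ X (z * w)].

Lemma sparse_coset (X : set G) c : ~ FC_center c ->
  (forall z z', X z -> X z' -> commute c (z'^-1 * z)) -> sparse X.
Proof.
move=> cF Xc w _; apply: (thin_coset cF) => z z' [Xz _] [Xz' _]; exact: Xc.
Qed.

Lemma sparse_point x : sparse [set x].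
Proof.
move=> w wF; apply: (thin_coset wF) => z z' /= [-> _] [-> _].
by rewrite mulVg; apply: commute1.
Qed.

Lemma sparse_conj k m : ~ FC_center k -> sparse [set z | z * k * z^-1 = m].
Proof.
move=> kF; apply: (sparse_coset kF) => z z' /= zk z'k; rewrite /commute.
have := etrans zk (esym z'k) => /(congr1 (fun t => z'^-1 * t * z)).
by rewrite !mulgA mulgVK mulVg mul1g => ->.
Qed.

(** If z and z * w both lie in this set, then x = z^-1 * u satisfies
    w^-1 * x * w^-1 = x, that is, x conjugates w to its inverse. Two elements x
    with this property differ by an element of the centralizer of w. *)
Lemma sparse_sqrt u a : sparse [set z | z^-1 * u * z^-1 = a].
Proof.
move=> w wF.
have inv z : z^-1 * u * z^-1 = a -> (z * w)^-1 * u * (z * w)^-1 = a ->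
    w ^ (z^-1 * u) = w^-1.
  rewrite !invgM !mulgA => <- /mulIg; rewrite -(mulgA w^-1).
  move: (z^-1 * u) => x e.
  by rewrite conjgE -{2}e -!mulgA mulVKg mulKg.
apply: (thin_coset wF) => z z' [za zwa] [z'a z'wa].
have /(congr1 (fun t => t ^ (z'^-1 * u)^-1)) := etrans (inv z za zwa)
  (esym (inv z' z'a z'wa)).
rewrite conjgK -conjgM invgM invgK !mulgA mulgK => /conjg_fixP/commgP wz.
by rewrite -[z'^-1 * z]invgK; apply: commuteV; rewrite invgM invgK.
Qed.

Lemma FC_separated n : finite_set FC_center -> infinite_set [set: G] ->
  exists gs : seq G, [/\ size gs = n, uniq gs
    & {in gs &, forall g h, g != h -> ~ FC_center (g^-1 * h)}].
Proof.
move=> /finite_seqP[fs fsE] Ginf; elim: n => [|n [gs [gsn gsu gsF]]].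
  by exists [::].
have [g _ ggs] := infinite_set_notin [seq h * f | h <- gs, f <- fs] Ginf.
have gF h : h \in gs -> ~ FC_center (h^-1 * g).
  move=> hgs; rewrite fsE /= => hg; case/negP: ggs.
  by rewrite -(mulVKg h g); apply: allpairs_f.
have gV h : h \in gs -> ~ FC_center (g^-1 * h).
  move=> hgs /FC_centerV; rewrite invgM invgK; exact: gF.
exists (g :: gs); split; rewrite /= ?gsn //.
  rewrite gsu andbT; apply/negP => /gF; rewrite mulVg; apply.
  exact: FC_center1.
move=> h k; rewrite !inE => /predU1P[->|hgs] /predU1P[->|kgs].
- by rewrite eqxx.
- by move=> _; apply: gV.
- by move=> _; apply: gF.
- exact: gsF.
Qed.

(** Take one more element g than there are sets, pairwise distinct modulo the
    FC-centre. Outside a thin set, the points z * g lie in different sparse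
    sets, so by the pigeonhole principle one of them lies in none. *)
Lemma sparse_cover_neq (I : eqType) (s : seq I) (X : I -> set G) :
    finite_set FC_center -> infinite_set [set: G] ->
    {in s, forall i, sparse (X i)} ->
  exists z, {in s, forall i, ~ X i z}.
Proof.
move=> Ffin Ginf sX.
have [gs [gsn gsu gsF]] := FC_separated (size s).+1 Ffin Ginf.
pose pairs := [seq p <- [seq (g, h) | g <- gs, h <- gs] | p.1 != p.2].
pose Y (q : (G * G) * I) := [set z | X q.2 (z * q.1.1) /\ X q.2 (z * q.1.2)].
have Ythin : {in [seq (p, i) | p <- pairs, i <- s], forall q, thin (Y q)}.
  move=> _ /allpairsP[[[g h] i] /= [gh is_ ->]].
  move: gh; rewrite mem_filter /= => /andP[gh /allpairsP[[g' h'] /= [gg hg]]].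
  move=> [eg eh]; rewrite -{}eg -{}eh in gg hg.
  have := thin_shift g (sX i is_ _ (gsF g h gg hg gh)).
  congr thin; apply/seteqP; split=> z; rewrite /Y /=.
    by rewrite -mulgA mulVKg.
  by rewrite -[in X in _ -> X]mulgA mulVKg.
have /thin_ex[z zY] := thin_seq Ythin.
apply: contrapT => no.
have /choice[r rP] g : exists i, i \in s /\ X i (z * g).
  apply: contrapT => noi; apply: no; exists (z * g) => i is_ Xi.
  by apply: noi; exists i.
have : (size (map r gs) <= size s)%N.
  apply: uniq_leq_size => [|_ /mapP[g ggs ->]]; last by have [] := rP g.
  rewrite map_inj_in_uniq // => g h ggs hgs rgh.
  apply: contrapT => /eqP gh; apply: zY; exists ((g, h), r g).
    apply: allpairs_f; last by have [] := rP g.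
    by rewrite mem_filter gh allpairs_f.
  by split=> /=; [|rewrite rgh]; have [] := rP g; have [] := rP h.
by rewrite size_map gsn ltnn.
Qed.

(** P holds outside finitely many sparse sets. *)
Definition generically (P : G -> Prop) := exists n (X : nat -> set G),
  (forall i, sparse (X i)) /\ forall z, (forall i, (i < n)%N -> ~ X i z) -> P z.

Lemma generically_ex P : finite_set FC_center -> infinite_set [set: G] ->
  generically P -> exists z, P z.
Proof.
move=> Ffin Ginf [n [X [Xs XP]]].
have [//|z zX] := @sparse_cover_neq _ (iota 0 n) X Ffin Ginf.
by exists z; apply: XP => i i_n; apply: zX; rewrite mem_iota.
Qed.

Lemma generically_true (P : G -> Prop) : (forall z, P z) -> generically P.
Proof.
move=> PT; exists 0%N, (fun=> set0); split=> // _ w _.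
by exists [::]; split=> // z [[]].
Qed.

Lemma generically_sparse X : sparse X -> generically (fun z => ~ X z).
Proof.
by move=> Xs; exists 1%N, (fun=> X); split=> // z /(_ 0%N); apply.
Qed.

Lemma generically_and P Q : generically P -> generically Q ->
  generically (fun z => P z /\ Q z).
Proof.
move=> [n [X [Xs XP]]] [m [Y [Ys YQ]]].
exists (n + m)%N, (fun i => if (i < n)%N then X i else Y (i - n)%N).
split=> [i|z zXY]; first by case: ifP.
split; [apply: XP => i i_n|apply: YQ => i i_m].
  by have := zXY i; rewrite i_n; apply; apply: ltn_addr.
by have := zXY (n + i)%N; rewrite ltn_add2l (ltnNge _ n) leq_addr addKn; apply.
Qed.

Lemma generically_seq (I : eqType) (s : seq I) (P : I -> G -> Prop) :
  {in s, forall i, generically (P i)} ->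
  generically (fun z => {in s, forall i, P i z}).
Proof.
elim: s => [|i s IHs] sP; first exact: generically_true.
have [n [X [Xs XP]]] : generically (fun z => P i z /\ {in s, forall i, P i z}).
  apply: generically_and; first by apply: sP; rewrite mem_head.
  by apply: IHs => j js; apply: sP; rewrite inE js orbT.
exists n, X; split=> // z /XP[Pi Ps] j.
by rewrite inE => /predU1P[->//|]; apply: Ps.
Qed.

(** * Avoiding noncommuting squares *)

(** Four elements x, y, xy and yx where x and y do not commute modulo the
    FC-centre. Such a configuration exists unless all the commutators lie in the
    FC-centre, and generic choices do not create it. *)
Definition noncommuting_square (q : seq G) := exists x y,
  q = [:: x; y; x * y; y * x] /\ ~ FC_center ((x * y) * (y * x)^-1).

Section Avoid.

Variables (T U : seq G) (z : G).
Hypothesis TV : inv_closed T.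
Hypothesis T_avoids : avoids noncommuting_square T.
(** Each condition below excludes points, cosets of centralizers of elements
    outside the FC-centre, or translated sets of square roots, hence holds for
    generic z. *)
Hypothesis new_prod : {in U & T, forall u t, {in T, forall t',
  z^-1 * u <> t * t'}}.
Hypothesis new_conj : {in U & T, forall u t, {in U, forall u',
  ~ FC_center t -> z * t * z^-1 <> u' * u^-1}}.
Hypothesis new_sqrt : {in U & T, forall u t, {in U, forall u',
  z^-1 * u * z^-1 <> t * u'^-1}}.
Hypothesis new_point : {in U & U, forall u d, {in U, forall e,
  z <> d * e^-1 * u}}.
Hypothesis new_twist : {in U & U, forall u e, {in U, forall f,
  ~ FC_center (e^-1 * u) -> z * (e^-1 * u) * z^-1 <> u * f^-1}}.

Let N := T ++ star z U.

(** The two symmetries below, exchanging x and y and inverting both, reduce the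
    nine cases given by the origin of x and y to four. *)
Definition square_at x y := [/\ x \in N, y \in N, x * y \in N, y * x \in N
  & ~ FC_center ((x * y) * (y * x)^-1)].

Let NV : inv_closed N := inv_closed_cat_star TV.

Lemma square_atC x y : square_at x y -> square_at y x.
Proof.
move=> [xT yT xyT yxT xyF]; split=> // /FC_centerV.
by rewrite invgM invgK.
Qed.

Lemma square_atV x y : square_at x y -> square_at y^-1 x^-1.
Proof.
move=> [xT yT xyT yxT xyF]; split; rewrite -?invgM; try exact: NV.
move=> /FC_centerV; rewrite invgK => /(FC_centerJ (y * x)^-1).
by rewrite conjgE invgK !mulgA mulgV mul1g.
Qed.

Lemma no_square_old x y : x \in T -> y \in T -> ~ square_at x y.
Proof.
have old_prod s t : s \in T -> t \in T -> s * t \in N -> s * t \in T.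
  move=> sT tT /mem_cat_starP[//|[u uU stE]|[u uU stE]].
    by case: (new_prod uU sT tT).
  have := new_prod uU (TV tT) (TV sT); case.
  by rewrite -invgM stE invgM invgK.
move=> xT yT [_ _ xyT yxT xyF].
apply: (T_avoids (q := [:: x; y; x * y; y * x])).
  by exists x, y.
move=> t; rewrite !inE => /or4P[] /eqP-> //; exact: old_prod.
Qed.

(** Here y * x gives the contradiction: a new value of it puts z in a coset of
    the centralizer of y, or makes a product z^-1 * u * z^-1 constant. *)
Lemma no_square_mixed u y : u \in U -> y \in T -> ~ square_at (z^-1 * u) y.
Proof.
move=> uU yT [_ _ _ yxT xyF].
have yF : ~ FC_center y by move=> yF; apply: xyF; apply: FC_center_comm; right.
have [vT|[u' u'U e]|[u' u'U e]] := mem_cat_starP yxT.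
- by apply: (new_prod uU (TV yT) vT); rewrite mulKg.
- apply: (new_conj uU yT u'U yF).
  by have := congr1 (fun t => z * t * u^-1) e; rewrite !gnorm.
- apply: (new_sqrt uU (TV yT) u'U).
  by have := congr1 (fun t => y^-1 * t * z^-1) e; rewrite !gnorm.
Qed.

(** The only values left for both products are inverses of new elements. The
    first equation gives z^-1 * d * z^-1, and substituting it in the second one
    puts z in a coset of the centralizer of e^-1 * u, unless this element is in
    the FC-centre; in that case x and y commute modulo the FC-centre. *)
Lemma no_square_new u d : u \in U -> d \in U ->
  ~ square_at (z^-1 * u) (z^-1 * d).
Proof.
move=> uU dU [_ _ xyT yxT xyF].
have half a b : a \in U -> b \in U -> z^-1 * a * (z^-1 * b) \in N ->
    exists2 e, e \in U & z^-1 * a * (z^-1 * b) = e^-1 * z.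
  move=> aU bU /mem_cat_starP[wT|[e eU we]|//].
    by case: (new_sqrt aU wT bU); rewrite !gnorm.
  case: (new_point aU bU eU).
  by have := congr1 (fun t => b * t^-1 * z^-1 * a) we; rewrite !gnorm.
have [e eU we] := half u d uU dU xyT; have [f fU vf] := half d u dU uU yxT.
have dE : z^-1 * d * z^-1 = u^-1 * z * e^-1.
  by have := congr1 (fun t => u^-1 * z * t * z^-1) we; rewrite !gnorm.
have twist : z * (e^-1 * u) * z^-1 = u * f^-1.
  move: vf; rewrite mulgA dE => vf.
  by have := congr1 (fun t => u * t * z^-1) vf; rewrite !gnorm.
have [euF|euF] := pselect (FC_center (e^-1 * u)); last first.
  exact: (new_twist uU eU fU euF).
rewrite we vf in xyF; apply: xyF.
have ufF : FC_center (u * f^-1).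
  by rewrite -twist; have := FC_centerJ z^-1 euF; rewrite conjgE !gnorm.
have -> : e^-1 * z * (f^-1 * z)^-1 = e^-1 * u * (u * f^-1)^-1 ^ u.
  by rewrite conjgE !gnorm.
by apply: FC_centerM => //; apply/FC_centerJ/FC_centerV.
Qed.

(** The product x * y is a conjugate by z^-1 of a constant, which lies
    outside the FC-centre since x and y do not commute modulo it. *)
Lemma no_square_opposite u d : u \in U -> d \in U ->
  ~ square_at (z^-1 * u) (d^-1 * z).
Proof.
move=> uU dU [_ _ xyT yxT xyF].
have [wT|[e eU we]|[e eU we]] := mem_cat_starP xyT.
- have wF : ~ FC_center (z^-1 * u * (d^-1 * z)).
    by move=> wF; apply: xyF; apply: FC_center_comm_prod.
  by apply: (new_conj dU wT uU wF); rewrite !gnorm.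
- case: (new_point eU dU uU).
  by have := congr1 (fun t => d * u^-1 * z * t) we; rewrite !gnorm.
- case: (new_point eU uU dU).
  by have := congr1 (fun t => z * t * z^-1 * e) we; rewrite !gnorm.
Qed.

Lemma avoids_star : avoids noncommuting_square N.
Proof.
suff no x y : ~ square_at x y.
  move=> _ [x [y [-> xyF]]] sub; apply: (no x y).
  by split=> //; apply: sub; rewrite !inE eqxx ?orbT.
move=> xy; have [xT yT _ _ _] := xy.
have [{}xT|[u uU xE]|[u uU xE]] := mem_cat_starP xT;
  have [{}yT|[d dU yE]|[d dU yE]] := mem_cat_starP yT.
- exact: no_square_old xT yT xy.
- by apply: (no_square_mixed dU xT); rewrite -yE; apply: square_atC.
- apply: (no_square_mixed dU (TV xT)).
  have -> : z^-1 * d = y^-1 by rewrite yE invgM invgK.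
  exact: square_atV.
- by apply: (no_square_mixed uU yT); rewrite -xE.
- by apply: (no_square_new uU dU); rewrite -xE -yE.
- by apply: (no_square_opposite uU dU); rewrite -xE -yE.
- apply: (no_square_mixed uU (TV yT)).
  have -> : z^-1 * u = x^-1 by rewrite xE invgM invgK.
  exact/square_atV/square_atC.
- by apply: (no_square_opposite dU uU); rewrite -xE -yE; apply: square_atC.
- apply: (no_square_new dU uU).
  have [-> ->] : z^-1 * d = y^-1 /\ z^-1 * u = x^-1.
    by rewrite xE yE !invgM !invgK.
  exact: square_atV.
Qed.

End Avoid.

Lemma avoidable_noncommuting_square :
  finite_set FC_center -> infinite_set [set: G] ->
  avoidable noncommuting_square.
Proof.
move=> Ffin Ginf T D U W TV TF disj.
have point x : generically (fun z => z <> x).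
  exact: generically_sparse (sparse_point x).
have conj k m : generically (fun z => ~ FC_center k -> z * k * z^-1 <> m).
  have [kF|kF] := pselect (FC_center k); first exact: generically_true.
  have [n [X [Xs XP]]] := generically_sparse (sparse_conj m kF).
  by exists n, X; split=> // z /XP.
have sqrt u a : generically (fun z => z^-1 * u * z^-1 <> a).
  exact: generically_sparse (sparse_sqrt u a).
have weaken (P Q : G -> Prop) : (forall z, P z -> Q z) -> generically P ->
    generically Q.
  by move=> PQ [n [X [Xs XP]]]; exists n, X; split=> // z /XP/PQ.
have seq2 (A B : seq G) (P : G -> G -> G -> Prop) :
    (forall a b, generically (P a b)) ->
    generically (fun z => {in A & B, forall a b, P a b z}).
  move=> PG.
  apply: (weaken (fun z => {in A, forall a, {in B, forall b, P a b z}})).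
    by move=> z Pz a b aA bB; apply: Pz.
  by do 2!apply: generically_seq => ? _.
have seq3 (A B C : seq G) (P : G -> G -> G -> G -> Prop) :
    (forall a b c, generically (P a b c)) ->
    generically (fun z => {in A & B, forall a b, {in C, forall c, P a b c z}}).
  by move=> PG; apply: seq2 => a b; apply: generically_seq => c _.
have div u d : generically (fun z => z^-1 * u <> d).
  apply: weaken (point (u * d^-1)) => z zE zud; apply: zE.
  by rewrite -zud !gnorm.
have [z [zD [zR [z1 [z2 [z3 [z4 z5]]]]]]] := generically_ex Ffin Ginf
  (generically_and (seq2 (U ++ W) D _ div)
  (generically_and (seq2 U W _ (fun u w => sqrt u w^-1))
  (generically_and (seq3 U T T _ (fun u t t' => div u (t * t')))
  (generically_and (seq3 U T U _ (fun u t u' => conj t (u' * u^-1)))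
  (generically_and (seq3 U T U _ (fun u t u' => sqrt u (t * u'^-1)))
  (generically_and (seq3 U U U _ (fun u d e => point (d * e^-1 * u)))
    (seq3 U U U _ (fun u e f => conj (e^-1 * u) (u * f^-1))))))))).
exists z; split.
- by move=> u uUW; apply/negP => zuD; apply: (zD u _ uUW zuD).
- move=> u w uU wW zuw; apply: (zR u w uU wW).
  by rewrite zuw !gnorm.
- exact: avoids_star.
Qed.

End FCCenter.

(** If the FC-centre were finite, noncommuting squares would be avoidable, so
    the CI property would exclude them and all commutators would lie in the
    FC-centre. Every conjugate of a would then be the product of a and one of
    finitely many elements: the whole group would be its own FC-centre. *)
Lemma infinite_FC_center (G : groupType) (e : nat -> G) :
    (forall x, exists n, e n = x) -> infinite_set [set: G] -> CI_group G ->
  infinite_set (@FC_center G).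
Proof.
move=> esurj Ginf CIG Ffin.
have [comF|/existsNP[x /existsNP[y xyF]]] :=
    pselect (forall x y : G, FC_center ((x * y) * (y * x)^-1)).
  apply: Ginf; apply: (sub_finite_set _ Ffin) => a _.
  apply: (FC_conj_sub (finite_image (fun t => a * t) Ffin)) => g.
  exists (a^-1 * a ^ g); last by rewrite mulVKg.
  have -> : a^-1 * a ^ g = (a^-1 * g^-1) * (g^-1 * a^-1)^-1.
    by rewrite conjgE !gnorm.
  exact: comF.
have inv (alpha : {multiplicative G -> G}) : bijective alpha ->
    forall q, noncommuting_square q -> noncommuting_square (map alpha q).
  move=> alphab _ [a [b [-> abF]]]; exists (alpha a), (alpha b).
  split; first by rewrite /= !gmulfM.
  move=> /= abF'; apply: abF; apply: (FC_center_aut alphab (@gmulfM _ _ alpha)).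
  by rewrite !gmulfM (morphV (@gmulfM _ _ alpha)) !gmulfM.
apply: (avoidable_not_CI esurj inv (avoidable_noncommuting_square Ffin Ginf)
  (q := [:: x; y; x * y; y * x])) => //.
- by move=> _ [a [b [-> _]]] /(_ a (mem_head _ _)).
- by exists x, y.
- have F1 := @FC_center1 G; rewrite !inE; apply/negP.
  move=> /or4P[] /eqP e1; apply: xyF.
  + by apply: FC_center_comm; left; rewrite -e1.
  + by apply: FC_center_comm; right; rewrite -e1.
  + by apply: FC_center_comm_prod; rewrite -e1.
  + by apply: FC_center_comm_prod; apply: FC_centerC; rewrite -e1.
Qed.

(** * Countable abelian subgroups *)

Lemma injective_sequence (T : eqType) (ok : seq T -> Prop) : ok [::] ->
    (forall s, ok s -> exists2 a, a \notin s & ok (a :: s)) ->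
  exists2 x : nat -> T, injective x &
    forall m n, exists s, [/\ ok s, x m \in s & x n \in s].
Proof.
move=> ok0 okS.
have [|t _ tP] := @iterated_choice _ ok
  (fun _ s s' => exists2 a, a \notin s & s' = a :: s) _ ok0.
  by move=> _ s /okS[a as_ oka]; exists (a :: s) => //; exists a.
have /choice[x xP] n : exists a, a \notin t n /\ t n.+1 = a :: t n.
  by have [_ [a]] := tP n; exists a.
have mem m n : (m < n)%N -> x m \in t n.
  elim: n => // n IHn; rewrite ltnS leq_eqVlt (xP n).2 inE.
  by move=> /predU1P[->|/IHn->]; rewrite ?eqxx ?orbT.
exists x.
  have neq m n : (m < n)%N -> x m <> x n.
    by move=> /mem mn xmn; have [/negP] := xP n; rewrite -xmn.
  move=> m n xmn; have [/neq//|/neq nm|//] := ltngtP m n.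
  by case: nm.
move=> m n; exists (t (maxn m n).+1); split.
  by have [] := tP (maxn m n).+1.
  by apply: mem; rewrite ltnS leq_maxl.
by apply: mem; rewrite ltnS leq_maxr.
Qed.

Section SequenceSubgroup.
Variables (G : groupType) (x : nat -> G).

Definition word_val (w : seq (bool * nat)) : G :=
  foldr (fun p a => (if p.1 then (x p.2)^-1 else x p.2) * a) 1 w.

Lemma word_val_cat v w : word_val (v ++ w) = word_val v * word_val w.
Proof. by elim: v => [|p v IHv] /=; rewrite ?mul1g // IHv mulgA. Qed.

Lemma word_val_rev w :
  word_val (rev [seq (~~ p.1, p.2) | p <- w]) = (word_val w)^-1.
Proof.
elim: w => [|[b n] w IHw]; first by rewrite /= invg1.
rewrite /= rev_cons -cats1 word_val_cat IHw invgM /= mulg1.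
by case: b; rewrite //= invgK.
Qed.

Lemma word_val_subgroup : is_subgroup (range word_val).
Proof.
apply/is_subgroupP; split; first by exists [::].
  by move=> _ [w _ <-]; exists (rev [seq (~~ p.1, p.2) | p <- w]) => //;
    rewrite word_val_rev.
by move=> _ _ [v _ <-] [w _ <-]; exists (v ++ w) => //; rewrite word_val_cat.
Qed.

Lemma word_val_commute : (forall m n, commute (x m) (x n)) ->
  forall v w, commute (word_val v) (word_val w).
Proof.
move=> xC.
have com1 a w : (forall n, commute a (x n)) -> commute a (word_val w).
  move=> ax; elim: w => [|[b n] w IHw] /=; first exact: commute1.
  by apply: commuteM => //; case: b => //=; apply: commuteV.
move=> v w; apply/commute_sym; elim: v => [|[b n] v IHv] /=.
  exact: commute1.
apply: commuteM => //; have: commute (word_val w) (x n).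
  by apply/commute_sym/com1 => m.
by case: b => //=; apply: commuteV.
Qed.

Lemma sequence_subgroup : injective x ->
  exists (H : groupType) (f : H -> G) (e : nat -> H),
    [/\ {morph f : a b / a * b}, injective f, forall a, exists n, e n = a,
        infinite_set [set: H]
      & (forall m n, commute (x m) (x n)) -> forall a b : H, commute a b].
Proof.
move=> x_inj; have [H] := subGroupType_of_is_subgroup word_val_subgroup.
have f_inj : injective (val : H -> G) := val_inj.
have fM : {morph (val : H -> G) : a b / a * b} := @valM _ _ H.
have valH (h : H) : exists w, val h = word_val w.
  by have /set_mem[w _ <-] := valP h; exists w.
have Hval w : exists h : H, val h = word_val w.
  have wP : word_val w \in range word_val by apply: mem_set; exists w.
  by exists (Sub (word_val w) wP); rewrite SubK.
pose e n : H :=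
  xget 1 [set h | exists2 w, unpickle n = Some w & val h = word_val w].
exists H, val, e; split=> //.
- move=> h; have [w hw] := valH h; exists (pickle w); apply: xget_unique.
    by exists w; rewrite ?pickleK.
  move=> k [v]; rewrite pickleK => -[<-] kv; apply: f_inj.
  by rewrite hw kv.
- move=> /finite_seqP[s sE].
  have /choice[y yP] n : exists h : H, val h = x n.
    by have [h] := Hval [:: (false, n)]; rewrite /= mulg1; exists h.
  have y_inj : injective y by move=> m n ymn; apply: x_inj; rewrite -!yP ymn.
  have : (size (map y (iota 0 (size s).+1)) <= size s)%N.
    apply: uniq_leq_size => [|h _]; first by rewrite map_inj_uniq ?iota_uniq.
    by have : [set: H] h by []; rewrite sE.
  by rewrite size_map size_iota ltnn.
- move=> /word_val_commute xC a b; apply: f_inj.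
  have [v av] := valH a; have [w bw] := valH b.
  by rewrite !fM av bw; apply: xC.
Qed.

End SequenceSubgroup.

Section Centralizers.
Variable G : groupType.

(** The centralizer of an element a of the FC-centre meets any infinite subgroup
    in an infinite subgroup: the elements conjugating a to a given conjugate
    form a coset of this intersection, and there are finitely many of them. *)
Lemma FC_center_centralizer_infinite (s : seq G) :
    infinite_set (@FC_center G) -> {in s, forall a, FC_center a} ->
  infinite_set [set b | FC_center b /\ {in s, forall a, commute a b}].
Proof.
move=> Finf; elim: s => [_|a s IHs sF].
  by apply: sub_infinite_set Finf => b bF; split.
set A := [set b | _ /\ {in s, forall a, _}] in IHs.
set B := [set b | _] => Bfin; apply: IHs.
  by move=> c cs; apply: sF; rewrite inE cs orbT.
pose fiber v := [set b | A b /\ a ^ b = v].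
have aF : FC_center a by apply: sF; rewrite mem_head.
apply: (sub_finite_set (B := \bigcup_(v in range (conjg a)) fiber v)).
  by move=> b Ab; exists (a ^ b); first exists b.
apply: bigcup_finite => // v _.
have [[b0 [Ab0 ab0]]|nofib] := pselect (exists b, fiber v b); last first.
  apply: (sub_finite_set _ (finite_set0 G)) => b fb; apply: nofib; exists b.
  exact: fb.
apply: (sub_finite_set _ (finite_image (fun c => c * b0) Bfin)) => b [Ab ab].
exists (b * b0^-1); last by rewrite mulgVK.
split; first by apply: FC_centerM; [case: Ab | apply: FC_centerV; case: Ab0].
move=> c; rewrite inE => /predU1P[->|cs].
  apply/commgP/conjg_fixP; rewrite conjgM ab -ab0.
  exact: conjgK.
apply: commuteM; first by case: Ab => _; apply.
by apply: commuteV; case: Ab0 => _; apply.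
Qed.

End Centralizers.

(** After passing to a countable subgroup, an infinite sequence of commuting
    elements is chosen greedily in the FC-centre, each in the centralizer of the
    previous ones. *)
Lemma CI_countable_abelian (G : groupType) :
    infinite_set [set: G] -> CI_group G ->
  exists (H : groupType) (e : nat -> H), [/\ forall a, exists n, e n = a,
    infinite_set [set: H], forall a b : H, commute a b & CI_group H].
Proof.
move=> Ginf CIG.
have [//||x x_inj _] := @injective_sequence G (fun=> True).
  by move=> s _; have [a _ as_] := infinite_set_notin s Ginf; exists a.
have [K [k [e [kM k_inj esurj Kinf _]]]] := sequence_subgroup x_inj.
have CIK := CI_embed kM k_inj CIG.
have Finf := infinite_FC_center esurj Kinf CIK.
pose ok (s : seq K) := {in s, forall a, FC_center a} /\ 
  {in s &, forall a b, commute a b}.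
have [|s [sF sC]|y y_inj yP] := @injective_sequence K ok.
- by split=> a; rewrite in_nil.
- have [b [bF bC] bs] := infinite_set_notin s
    (FC_center_centralizer_infinite Finf sF).
  exists b => //; split=> [a|a c]; first by rewrite inE => /predU1P[->|/sF].
  rewrite !inE => /predU1P[->|as_] /predU1P[->|cs].
  + exact: commute_refl.
  + by apply: commute_sym; apply: bC.
  + exact: bC.
  + exact: sC.
have [H [h [e' [hM h_inj e'surj Hinf HC]]]] := sequence_subgroup y_inj.
exists H, e'; split=> //; last exact: CI_embed hM h_inj CIK.
by apply: HC => m n; have [s [[_ sC] ms ns]] := yP m n; apply: sC.
Qed.

Section Doubling.
Variable G : groupType.

(** Abelian groups contain no [noncommuting_square]; these pairs replace them
    there. *)
Definition doubling (q : seq G) := exists x, q = [:: x; x * x].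

(** Let y = z^-1 * u be new. If y^2 is old, y is one of finitely many square
    roots. If y^2 = z^-1 * d, then y = u^-1 * d. If y^2 = d^-1 * z, then
    y^3 = d^-1 * u. All of this excludes finitely many z. *)
Lemma avoidable_doubling : infinite_set [set: G] ->
    (forall a : G, finite_set [set y | y * y = a]) ->
    (forall a : G, finite_set [set y | y * y * y = a]) ->
  avoidable doubling.
Proof.
move=> Ginf sqfin cbfin T D U W TV TF disj.
pose UW := U ++ W.
pose A := D ++ T ++ [seq t * t | t <- T] ++ [seq u^-1 * v | u <- UW, v <- UW].
pose B := [set y | [\/ y \in A, y * y \in A | y * y * y \in A]].
have Bfin : finite_set B.
  apply: (sub_finite_set (B := [set` A] `|` (\bigcup_(a in [set` A])
      ([set y | y * y = a] `|` [set y | y * y * y = a])))).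
    move=> y [yA|yA|yA]; [by left|right..].
      by exists (y * y) => //; left.
    by exists (y * y * y) => //; right.
  rewrite finite_setU; split; first exact: finite_seq.
  apply: bigcup_finite => [|a _]; first exact: finite_seq.
  by rewrite finite_setU; split.
have [z zB] : exists z, {in UW, forall u, ~ B (z^-1 * u)}.
  apply: contrapT => no; apply: Ginf.
  apply: (sub_finite_set (B := \bigcup_(u in [set` UW])
    (fun y => u * y^-1) @` B)) => [z _|].
    apply: contrapT => nz; apply: no; exists z => u uUW Bzu; apply: nz.
    by exists u => //; exists (z^-1 * u); rewrite // invgM invgK mulVKg.
  apply: bigcup_finite => [|u _]; first exact: finite_seq.
  exact: finite_image.
have UUW u : u \in U -> u \in UW by rewrite mem_cat => ->.
have TA t : t \in T -> t \in A by rewrite !mem_cat => ->; rewrite !orbT.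
have TTA t : t \in T -> t * t \in A.
  by move=> tT; rewrite !mem_cat (map_f (fun t => t * t)) ?orbT.
have divA u v : u \in UW -> v \in UW -> u^-1 * v \in A.
  by move=> uU vU; rewrite !mem_cat; do 3![apply/orP; right]; apply: allpairs_f.
exists z; split.
- move=> u uUW; apply/negP => zuD; apply: (zB u uUW); apply: Or31.
  by rewrite mem_cat zuD.
- move=> u w uU wW zuw; apply: (zB u (UUW u uU)); apply: Or32.
  rewrite {1}zuw mulgA mulgK; apply: divA; last exact: UUW.
  by rewrite mem_cat wW orbT.
have new u : u \in U -> z^-1 * u * (z^-1 * u) \notin T ++ star z U.
  move=> uU; apply/negP => /mem_cat_starP[yT|[d dU ydE]|[d dU ydE]];
    apply: (zB u (UUW u uU)).
  - by apply: Or32; apply: TA.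
  - apply: Or31; suff -> : z^-1 * u = u^-1 * d by apply: divA; apply: UUW.
    by apply: (mulgI (z^-1 * u)); rewrite ydE !gnorm.
  - apply: Or33; rewrite ydE mulgA mulgK.
    by apply: divA; apply: UUW.
move=> _ [x ->] sub.
have xN : x \in T ++ star z U by apply: sub; rewrite !inE eqxx.
have xxN : x * x \in T ++ star z U by apply: sub; rewrite !inE eqxx orbT.
have [xT|[u uU xE]|[u uU xE]] := mem_cat_starP xN; last 2 first.
- by case/negP: (new u uU); rewrite -xE.
- case/negP: (new u uU).
  have -> : z^-1 * u = x^-1 by rewrite xE invgM invgK.
  by rewrite -invgM; apply: inv_closed_cat_star.
have [xxT|[u uU xxE]|[u uU xxE]] := mem_cat_starP xxN.
- apply: (TF [:: x; x * x]); first by exists x.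
  by move=> y; rewrite !inE => /orP[] /eqP->.
- by apply: (zB u (UUW u uU)); apply: Or31; rewrite -xxE; apply: TTA.
- apply: (zB u (UUW u uU)); apply: Or31.
  have -> : z^-1 * u = x^-1 * x^-1 by rewrite -invgM xxE invgM invgK.
  exact/TTA/TV.
Qed.

Theorem finite_roots_not_CI (e : nat -> G) : (forall x, exists n, e n = x) ->
    infinite_set [set: G] ->
    (forall a : G, finite_set [set y | y * y = a]) ->
    (forall a : G, finite_set [set y | y * y * y = a]) ->
  ~ CI_group G.
Proof.
move=> esurj Ginf sqfin cbfin.
have [x xx1] : exists x : G, x * x <> 1.
  apply: contrapT => no; apply: Ginf; apply: (sub_finite_set _ (sqfin 1)).
  by move=> x _; apply: contrapT => xx1; apply: no; exists x.
apply: (avoidable_not_CI esurj _ (avoidable_doubling Ginf sqfin cbfin)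
  (q := [:: x; x * x])).
- move=> alpha _ _ [y ->]; exists (alpha y).
  by rewrite /= gmulfM.
- by move=> _ [y ->] /(_ y (mem_head _ _)).
- by exists x.
- rewrite !inE; apply/negP => /orP[] /eqP e1; apply: xx1; rewrite -?e1 //.
  by rewrite mulg1.
Qed.

End Doubling.

Definition torsion_elements (G : groupType) (p : nat) : set G :=
  [set x | x ^+ p = 1].
Arguments torsion_elements : clear implicits.

Lemma finite_roots (H : groupType) p : (forall a b : H, commute a b) ->
  finite_set (torsion_elements H p) ->
  forall a : H, finite_set [set y | y ^+ p = a].
Proof.
move=> HC pfin a; have [[y0 y0a]|no] := pselect (exists y0, y0 ^+ p = a).
  apply: (sub_finite_set _ (finite_image (fun t => t * y0) pfin)) => y /= ya.
  exists (y * y0^-1); last by rewrite mulgVK.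
  rewrite /torsion_elements /= expgnFl ?ya ?y0a ?mulgV //.
by apply: (sub_finite_set _ (finite_set0 H)) => y ya; apply: no; exists y.
Qed.

Lemma CI_infinite_torsion (H : groupType) (e : nat -> H) :
    (forall x, exists n, e n = x) -> infinite_set [set: H] ->
    (forall a b : H, commute a b) -> CI_group H ->
  infinite_set (torsion_elements H 2) \/ infinite_set (torsion_elements H 3).
Proof.
move=> esurj Hinf HC CIH; apply: contrapT.
move=> /not_orP[/contrapT f2 /contrapT f3].
apply: (finite_roots_not_CI esurj Hinf _ _ CIH) => a.
  exact: finite_roots HC f2 a.
apply: sub_finite_set (finite_roots HC f3 a) => y /= <-.
by rewrite expgS expg2 mulgA.
Qed.

(** * A pairing between directions and monomials over a prime field *)

Section Monomials.
Import mathcomp.boot.fintype mathcomp.boot.finset GRing.Theory.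
Local Open Scope ring_scope.
Variable p : nat.
Hypothesis p_prime : prime p.
Let n := p.*2.-1.
Implicit Types (K L J E : {set 'I_n}) (a d e : 'I_n -> 'F_p).

Lemma card_supersets J : (#|J| <= p)%N ->
  #|[set K : {set 'I_n} | (J \subset K) && (#|K| == p)]| =
  'C(n - #|J|, p - #|J|).
Proof.
move=> Jp; have -> : (n - #|J|)%N = #|~: J|.
  by rewrite -[X in (X - _)%N]card_ord -(cardsC J) addKn.
rewrite -cards_draws.
pose D := [set A : {set 'I_n} | A \subset ~: J & #|A| == (p - #|J|)%N].
rewrite -/D.
have <- : #|[set J :|: A | A in D]| = #|D|.
  apply: card_in_imset => A B; rewrite !inE => /andP[AJ _] /andP[BJ _] AB.
  have disj (A' : {set 'I_n}) : A' \subset ~: J -> (J :|: A') :\: J = A'.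
    by rewrite setDUl setDv set0U setDE => /setIidPl.
  by rewrite -(disj A AJ) -(disj B BJ) AB.
apply: eq_card => K; rewrite inE; apply/andP/imsetP => [[JK /eqP Kp]|[A]].
  exists (K :\: J); last by rewrite -{1}(setIidPr JK) setID.
  rewrite inE setDE subsetIr /= -setDE cardsD (setIidPr JK) Kp; exact: eqxx.
rewrite inE => /andP[AJ /eqP Ap] ->; rewrite subsetUl; split=> //.
rewrite cardsU (_ : J :&: A = set0) ?cards0 ?subn0 ?Ap ?subnKC //.
by apply/eqP; rewrite setI_eq0 disjoint_sym disjoints_subset.
Qed.

Lemma prime_ndvd_fact k : (k < p)%N -> ~~ (p %| k`!)%N.
Proof.
elim: k => [|k IHk] kp; first by rewrite dvdn1 gtn_eqF ?prime_gt1.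
by rewrite factS Euclid_dvdM // negb_or gtnNdvd // IHk // ltnW.
Qed.

(** With n = 2p - 1 the numerator (n - j)! is divisible by p since n - j >= p,
    while the factorials in the denominator are not. *)
Lemma prime_dvd_bin_below j : (0 < j < p)%N -> (p %| 'C(n - j, p - j))%N.
Proof.
move=> /andP[j0 jp].
have [le pn] : (p - j <= n - j)%N /\ (p <= n - j)%N by rewrite /n; lia.
have : (p %| (n - j)`!)%N by rewrite dvdn_fact // prime_gt0.
rewrite -(bin_fact le) !Euclid_dvdM // => /or3P[//|dvd|dvd].
  by have /negP[] : ~~ (p %| (p - j)`!)%N by apply: prime_ndvd_fact; lia.
have /negP[//] : ~~ (p %| (n - j - (p - j))`!)%N.
by apply: prime_ndvd_fact; rewrite /n; lia.
Qed.

(** 'C(2p - 1, p) is the quotient of (p + 1) ... (2p - 1) by (p - 1)!. *)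
Lemma prime_ndvd_bin : ~~ (p %| 'C(n, p))%N.
Proof.
have p1 := prime_gt1 p_prime.
have -> : 'C(n, p) = 'C(n, p.-1).
  by rewrite -bin_sub; [congr 'C(_, _)|]; rewrite /n; lia.
suff: ~~ (p %| 'C(n, p.-1) * (p.-1)`!)%N by rewrite Euclid_dvdM // => /norP[].
rewrite bin_ffact ffact_prod Euclid_dvd_prod // big_has.
apply/hasPn => i _.
have -> : (n - i = (p.-1 - i) + p)%N by have := ltn_ord i; rewrite /n; lia.
by rewrite dvdn_addl // gtnNdvd //; have := ltn_ord i; lia.
Qed.

Definition mono a L := \prod_(i in L) a i.

(** The left-hand side is the product over all i of c_i + e_i, where c_i is a_i
    on K and 0 elsewhere. *)
Lemma mono_expand a e K :
  mono (fun i => a i + e i) K * mono e (~: K) =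
  \sum_(J : {set 'I_n} | J \subset K) mono a J * mono e (~: J).
Proof.
transitivity (\prod_i ((if i \in K then a i else 0) + e i)).
  rewrite (bigID (mem K)) /=; congr (_ * _).
    by apply: eq_bigr => i ->.
  apply: eq_big => [i|i iK]; first by rewrite inE.
  by rewrite inE in iK; rewrite (negPf iK) add0r.
rewrite bigA_distr [RHS]big_mkcond /=; apply: eq_bigr => J _.
case: ifP => [JK|/negbT/subsetPn[i iJ iK]]; last first.
  by rewrite (bigD1 i) //= iJ (negPf iK) mul0r.
rewrite (bigID (mem J)) /=; congr (_ * _).
  by apply: eq_bigr => i iJ; rewrite iJ (subsetP JK i iJ).
by apply: eq_big => [i|i iJ]; rewrite ?inE // (negPf iJ).
Qed.

Definition pairing e (b : {set 'I_n} -> 'F_p) :=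
  \sum_(K : {set 'I_n} | #|K| == p) mono e (~: K) * b K.

(** Expanding the left-hand side, the term mono a J * mono e (~: J) appears once
    for each K of size p containing J. The number of these K is divisible by p
    for J nonempty of size less than p, the terms with J of size p cancel with
    the second sum, and the term with J empty is the right-hand side. *)
Lemma pairing_mono a e :
  pairing e (mono (fun i => a i + e i)) - pairing e (mono a) =
  'C(n, p)%:R * mono e setT.
Proof.
have -> : pairing e (mono (fun i => a i + e i)) =
    \sum_J mono a J * mono e (~: J) *
      #|[set K : {set 'I_n} | (J \subset K) && (#|K| == p)]|%:R.
  rewrite /pairing; under eq_bigr do rewrite mulrC mono_expand big_mkcond.
  rewrite exchange_big /=; apply: eq_bigr => J _.
  rewrite -sum1_card natr_sum mulr_sumr big_mkcond [RHS]big_mkcond /=.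
  apply: eq_bigr => K _; rewrite inE mulr1.
  by case: (_ == p); case: (J \subset K).
(* the subsets J of size p contribute exactly the second sum *)
rewrite (bigID (fun J => #|J| == p)) /= addrAC -[RHS]add0r; congr (_ + _).
  apply/eqP; rewrite subr_eq0; apply/eqP; apply: eq_bigr => J /eqP Jp.
  by rewrite card_supersets ?Jp // subnn bin0 mulr1 mulrC.
rewrite (bigD1 set0) /=; last by rewrite cards0 eq_sym gtn_eqF // prime_gt0.
rewrite big1 ?addr0 => [|J /andP[Jp J0]].
  by rewrite card_supersets cards0 ?subn0 // /mono big_set0 mul1r setC0 mulrC.
have [Jltp|pJ] := leqP #|J| p.
  have Jlt : (0 < #|J| < p)%N by rewrite card_gt0 J0 ltn_neqAle Jp Jltp.
  rewrite card_supersets //; have := prime_dvd_bin_below Jlt.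
  by rewrite (dvdn_pcharf (pchar_Fp p_prime)) => /eqP->; rewrite mulr0.
rewrite (_ : [set K | _ & _] = set0) ?cards0 ?mulr0 //.
apply/setP=> K; rewrite !inE; apply/negP => /andP[/subset_leq_card + /eqP Kp].
by rewrite Kp leqNgt pJ.
Qed.

(** For p = 2 this is the equality of 1 and -1. *)
Lemma signr_Fp : (-1) ^+ p = -1 :> 'F_p.
Proof.
have [p2|podd] := even_prime p_prime; last by rewrite -signr_odd podd expr1.
by rewrite p2; apply/eqP.
Qed.

Lemma card_setC_half K : #|K| = p -> #|~: K| = p.-1.
Proof.
move=> Kp; have := cardsC K; rewrite card_ord Kp /n.
by have := prime_gt1 p_prime; lia.
Qed.

Lemma pairing_opp e b :
  pairing (fun i => - e i) (fun K => - b K) = - pairing e b.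
Proof.
rewrite /pairing -sumrN; apply: eq_bigr => K /eqP Kp.
have cK := card_setC_half Kp.
have s1 : (-1) ^+ p.-1 = 1 :> 'F_p.
  have := exprS (-1 : 'F_p) p.-1.
  by rewrite prednK ?prime_gt0 // signr_Fp mulN1r => /oppr_inj.
by rewrite /mono prodrN cK s1 mul1r mulrN.
Qed.

Lemma mono_opp e : mono (fun i => - e i) setT = - mono e setT.
Proof.
rewrite /mono prodrN cardsT card_ord -signr_odd.
have -> : odd n by rewrite /n; have := prime_gt1 p_prime; lia.
by rewrite expr1 mulN1r.
Qed.

(** Adding to E, or removing from it, a fixed element outside L changes the sign
    of the term. *)
Lemma alternating_sum_supersets L : L != setT ->
  \sum_(E : {set 'I_n}) (-1) ^+ #|E| * (L \subset E)%:R = 0 :> 'F_p.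
Proof.
rewrite -subTset => /subsetPn[i _ iL].
rewrite (bigID (fun E : {set 'I_n} => i \in E)) /=.
rewrite (reindex_onto (fun E => i |: E) (fun E => E :\ i)) /=; last first.
  by move=> E; apply: setD1K.
rewrite [X in _ + X](eq_bigl (fun E => (i \in i |: E) && ((i |: E) :\ i == E))).
  rewrite -big_split /= big1 // => E /andP[_ /eqP iE].
  have nE : i \notin E by rewrite -iE !inE eqxx.
  have -> : (L \subset i |: E) = (L \subset E).
    apply/subsetP/subsetP => sub j jL; last by rewrite inE sub ?orbT.
    have := sub j jL; rewrite !inE => /orP[/eqP ji|//].
    by rewrite ji (negPf iL) in jL.
  by rewrite cardsU1 nE exprS mulN1r mulNr addNr.
move=> E; rewrite setU11 /=; apply/idP/eqP => [nE|<-]; first exact: setU1K.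
by rewrite !inE eqxx.
Qed.

Definition indicator E : 'I_n -> 'F_p := fun i => (i \in E)%:R.

Lemma mono_indicator E L : mono (indicator E) L = (L \subset E)%:R.
Proof.
case: (boolP (L \subset E)) => [LE|/subsetPn[i iL iE]].
  by rewrite /mono big1 // => i iL; rewrite /indicator (subsetP LE).
by rewrite /mono (bigD1 i) //= /indicator (negPf iE) mul0r.
Qed.

(** If b depends additively on the direction e, the pairing of e with b is a
    polynomial of degree at most p in the coordinates of e, whereas the product
    of all coordinates has degree 2p - 1 > p. The alternating sum over the cube
    of indicator functions tells them apart. *)
Lemma pairing_not_linear (beta : 'I_n -> {set 'I_n} -> 'F_p) :
  ~ (forall E, pairing (indicator E) (fun K => \sum_(m in E) beta m K)
               = 'C(n, p)%:R * mono (indicator E) setT).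
Proof.
move=> lin; have p1 := prime_gt1 p_prime.
have : \sum_(E : {set 'I_n}) (-1) ^+ #|E| *
    pairing (indicator E) (fun K => \sum_(m in E) beta m K) = 0.
  transitivity (\sum_(K : {set 'I_n} | #|K| == p) \sum_m beta m K *
      \sum_(E : {set 'I_n}) (-1) ^+ #|E| * (m |: ~: K \subset E)%:R).
    rewrite /pairing; under eq_bigr do rewrite mulr_sumr.
    rewrite exchange_big /=; apply: eq_bigr => K _.
    transitivity (\sum_(E : {set 'I_n}) \sum_m beta m K *
        ((-1) ^+ #|E| * (m |: ~: K \subset E)%:R)).
      apply: eq_bigr => E _.
      rewrite mono_indicator big_mkcond mulr_sumr mulr_sumr.
      apply: eq_bigr => m _; rewrite subUset sub1set.
      by case: (m \in E); case: (~: K \subset E);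
        rewrite ?(mulr0, mul0r, mulr1, mul1r) // mulrC.
    by rewrite exchange_big /=; apply: eq_bigr => m _; rewrite mulr_sumr.
  apply: big1 => K /eqP Kp; apply: big1 => m _.
  rewrite alternating_sum_supersets ?mulr0 //.
  apply/eqP => full; have : (#|m |: ~: K| <= p)%N.
    apply: leq_trans (leq_card_setU _ _).1 _; rewrite cards1.
    by rewrite card_setC_half // add1n prednK ?prime_gt0.
  by rewrite full cardsT card_ord /n; lia.
under eq_bigr do rewrite lin mono_indicator subTset.
rewrite (bigD1 setT) //= eqxx mulr1 big1 ?addr0 => [|E /negPf->]; last first.
  by rewrite !mulr0.
move/eqP; rewrite mulf_eq0 signr_eq0 /= -(dvdn_pcharf (pchar_Fp p_prime)).
exact/negP/prime_ndvd_bin.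
Qed.

End Monomials.

(** * Large elementary abelian groups *)

(** The additive group of V in multiplicative notation. *)
Definition mult_copy (V : zmodType) : Type := V.

Section MultCopy.
Variable V : zmodType.
Local Notation M := (mult_copy V).
HB.instance Definition _ := Choice.on M.
HB.instance Definition _ := isGroup.Build M (@GRing.addrA V) (@GRing.add0r V)
  (@GRing.addr0 V) (@GRing.addNr V) (@GRing.subrr V).

End MultCopy.

Section ElementaryAbelian.
Variable p : nat.
Hypothesis p_prime : prime p.
Import mathcomp.boot.fintype mathcomp.boot.finset GRing.Theory.

Section NotCI.
Local Open Scope ring_scope.
Let n := p.*2.-1.
Let cst : 'F_p := 'C(n, p)%:R.

Definition pair_space : zmodType :=
  ({ffun 'I_n -> 'F_p} * {ffun {set 'I_n} -> 'F_p})%type.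
Let M : groupType := mult_copy pair_space.

(** A vertex is a direction d together with a shift b. The flat set contains all
    (d, 0) with d <> 0, so together with the identity it contains a subgroup
    projecting isomorphically to the directions. *)
Definition flat_set : M -> Prop := fun v : pair_space =>
  v.1 <> 0 /\ pairing (p := p) v.1 v.2 = 0.

(** By [pairing_not_linear] this set contains no such subgroup. *)
Definition twisted_set : M -> Prop := fun v : pair_space =>
  v.1 <> 0 /\ pairing (p := p) v.1 v.2 = cst * mono (p := p) v.1 setT.

Definition monomials (d : {ffun 'I_n -> 'F_p}) : {ffun {set 'I_n} -> 'F_p} :=
  [ffun K => mono (p := p) d K].

Lemma ffun_oppE (I : finType) (f : {ffun I -> 'F_p}) :
  (- f : {ffun I -> 'F_p}) = (fun i => - f i) :> (I -> 'F_p).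
Proof. by apply: funext => i; rewrite ffunE. Qed.

Lemma ffun_addE (I : finType) (f g : {ffun I -> 'F_p}) :
  (f + g : {ffun I -> 'F_p}) = (fun i => f i + g i) :> (I -> 'F_p).
Proof. by apply: funext => i; rewrite ffunE. Qed.

Lemma pairingD (e : 'I_n -> 'F_p) (b b' : {ffun {set 'I_n} -> 'F_p}) :
  pairing e (b + b') = pairing e b + pairing e b'.
Proof.
by rewrite /pairing -big_split /=; apply: eq_bigr => K _; rewrite ffunE mulrDr.
Qed.

Lemma pairingN (e : 'I_n -> 'F_p) (b : {ffun {set 'I_n} -> 'F_p}) :
  pairing e (- b) = - pairing e b.
Proof.
by rewrite /pairing -sumrN; apply: eq_bigr => K _; rewrite ffunE mulrN.
Qed.

Lemma pairing_monomials (a e : {ffun 'I_n -> 'F_p}) :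
  pairing (p := p) e (- monomials a + monomials (a + e)) =
  cst * mono (p := p) e setT.
Proof.
rewrite pairingD pairingN addrC -(pairing_mono p_prime a e) -ffun_addE.
by congr (_ - _); apply: eq_bigr => K _; rewrite ffunE.
Qed.

Lemma connection_set_flat : connection_set flat_set.
Proof.
apply/connection_setP; split=> [[]//|v [d0 vp]]; split.
  by move/eqP; rewrite oppr_eq0 => /eqP.
by rewrite /= !ffun_oppE pairing_opp // vp oppr0.
Qed.

Lemma connection_set_twisted : connection_set twisted_set.
Proof.
apply/connection_setP; split=> [[]//|v [d0 vp]]; split.
  by move/eqP; rewrite oppr_eq0 => /eqP.
by rewrite /= !ffun_oppE pairing_opp // vp mono_opp // mulrN.
Qed.

(** Shifting the second coordinate by the monomials of the first one is an
    isomorphism by [pairing_mono]. *)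
Lemma flat_twisted_iso : graph_iso (Cay flat_set) (Cay twisted_set).
Proof.
pose phi (v : pair_space) : pair_space := (v.1, v.2 + monomials v.1).
exists (phi : M -> M).
  exists (fun v : pair_space => (v.1, v.2 - monomials v.1) : pair_space).
    by move=> [d b]; rewrite /phi /= addrK.
  by move=> [d b]; rewrite /phi /= subrK.
move=> x y; rewrite !CayP; pose e := - x.1 + y.1.
have y1 : y.1 = x.1 + e by rewrite addrA subrr add0r.
rewrite /flat_set /twisted_set.
rewrite -[((phi x : M)^-1 * (phi y : M))%g]/(- phi x + phi y : pair_space).
rewrite -[(x^-1 * y)%g]/(- x + y : pair_space) /= -/e.
have -> : - (x.2 + monomials x.1) + (y.2 + monomials y.1) =
    (- x.2 + y.2) + (- monomials x.1 + monomials (x.1 + e)).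
  by rewrite -y1 opprD addrACA.
rewrite [in X in _ <-> X]pairingD pairing_monomials.
split=> -[e0 ve]; split=> //; first by rewrite ve add0r.
by apply: (addIr (cst * mono (p := p) e setT)); rewrite add0r.
Qed.

(** An automorphism carrying the flat set to the twisted set maps the
    elements (d, 0) to a subgroup of pairs (e, l e) with l additive, and
    membership in the twisted set says exactly that the pairing of e with l e
    is the product of the coordinates of e up to a nonzero constant. *)
Theorem pair_space_not_CI : ~ CI_group M.
Proof.
move=> CIM.
have [alpha alphab aS] := CIM _ connection_set_flat _ connection_set_twisted
  flat_twisted_iso.
pose al (v : pair_space) : pair_space := alpha v.
have alD (v w : pair_space) : al (v + w) = al v + al w.
  exact: (@gmulfM _ _ alpha v w).
pose a (d : {ffun 'I_n -> 'F_p}) : {ffun 'I_n -> 'F_p} := (al (d, 0)).1.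
pose beta (d : {ffun 'I_n -> 'F_p}) : {ffun {set 'I_n} -> 'F_p} :=
  (al (d, 0)).2.
have al_pair (d e : {ffun 'I_n -> 'F_p}) :
    al (d + e, 0) = al (d, 0) + al (e, 0).
  by rewrite -alD -[in LHS](addr0 (0 : {ffun {set 'I_n} -> 'F_p})).
have aD (d e : {ffun 'I_n -> 'F_p}) : a (d + e) = a d + a e.
  by rewrite /a al_pair.
have betaD (d e : {ffun 'I_n -> 'F_p}) : beta (d + e) = beta d + beta e.
  by rewrite /beta al_pair.
have twisted (d : {ffun 'I_n -> 'F_p}) : d <> 0 -> twisted_set (al (d, 0)).
  move=> d0; rewrite -aS; exists (d, 0) => //; split=> //=.
  by rewrite /pairing big1 // => K _; rewrite ffunE mulr0.
have a0 : a 0 = 0 by apply: (addrI (a 0)); rewrite -aD !addr0.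
have beta0 : beta 0 = 0 by apply: (addrI (beta 0)); rewrite -betaD !addr0.
have a_inj : injective a.
  move=> d e ade; apply/eqP; rewrite -subr_eq0; apply/eqP.
  apply: contrapT => /twisted[+ _]; apply.
  rewrite -/(a _); apply: (addIr (a e)); rewrite -aD subrK ade add0r //.
have [c aK cK] : bijective a by exact: injF_bij a_inj.
pose l (e : {ffun 'I_n -> 'F_p}) : {ffun {set 'I_n} -> 'F_p} := beta (c e).
have lD (d e : {ffun 'I_n -> 'F_p}) : l (d + e) = l d + l e.
  by rewrite /l -betaD; congr beta; apply: a_inj; rewrite aD !cK.
have l0 : l 0 = 0 by rewrite /l -a0 aK.
have lP (e : {ffun 'I_n -> 'F_p}) :
    pairing (p := p) e (l e) = cst * mono (p := p) e setT.
  have [->|e0] := eqVneq e 0.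
    rewrite l0 /pairing big1 => [|K _]; last by rewrite !ffunE mulr0.
    have n0 : (0 < n)%N by rewrite /n; have := prime_gt1 p_prime; lia.
    by rewrite /mono (bigD1 (Ordinal n0)) ?in_setT //= ffunE mul0r mulr0.
  (* the twisted set only constrains nonzero directions *)
  have e'0 : c e <> 0.
    by move=> e'0; case/eqP: e0; rewrite -(cK e) e'0.
  by have [_] := twisted _ e'0; rewrite -/(a _) -/(beta _) cK.
(* the basis of the directions, on which the indicator functions decompose *)
pose delta m : {ffun 'I_n -> 'F_p} := [ffun i => (i == m)%:R].
apply: (pairing_not_linear p_prime (beta := fun m => l (delta m))) => E.
have -> : indicator E = (\sum_(m in E) delta m : {ffun 'I_n -> 'F_p}).
  apply: funext => i; rewrite sum_ffunE /indicator; apply/esym.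
  case: (boolP (i \in E)) => iE.
    rewrite (bigD1 i) //= ffunE eqxx big1 ?addr0 // => m /andP[_ mi].
    by rewrite ffunE eq_sym (negPf mi).
  rewrite big1 // => m mE; rewrite ffunE; case: eqVneq => // im.
  by rewrite im mE in iE.
rewrite -lP (big_morph l lD l0).
by congr pairing; apply: funext => K; rewrite sum_ffunE.
Qed.

End NotCI.

Section Embedding.
Variable H : groupType.
Hypothesis HC : forall a b : H, commute a b.
Hypothesis H_inf : infinite_set (torsion_elements H p).
Local Open Scope group_scope.

Lemma expg_modn (x : H) m : x ^+ p = 1 -> x ^+ (m %% p) = x ^+ m.
Proof.
by move=> xp; rewrite {2}(divn_eq m p) expgnDr mulnC expgnA xp expg1n mul1g.
Qed.

Lemma modn_Fp m : m %% (Zp_trunc (pdiv p)).+2 = m %% p.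
Proof. by rewrite Fp_cast. Qed.

(** Coordinates are added one at a time. The image x of a new one is chosen
    of order p and outside the finite image of the morphism f built so far;
    if x ^+ a * f u = 1 with a nonzero in 'F_p, then raising to the power
    a^-1 puts x in the image of f. *)
Lemma elementary_abelian_embed (K : finType) :
  exists2 f : {ffun K -> 'F_p} -> H,
    forall u v, f (u + v)%R = f u * f v & injective f.
Proof.
suff [f fD f1] : exists2 f : {ffun K -> 'F_p} -> H,
    forall u v, f (u + v)%R = f u * f v &
    forall u, f u = 1 -> {in enum K, forall k, u k = 0%R}.
  exists f => // u v fuv.
  have f0 : f 0%R = 1 by apply: (mulgI (f 0%R)); rewrite -fD GRing.addr0 mulg1.
  have /f1 uv : f (u - v)%R = 1.
    by apply: (mulIg (f v)); rewrite -fD GRing.subrK mul1g.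
  apply/ffunP => k; apply/eqP; rewrite -GRing.subr_eq0; apply/eqP.
  by have := uv k (mem_enum _ _); rewrite !ffunE.
elim: (enum K) => [|k s [f fD f1]].
  by exists (fun=> 1) => // x y; rewrite mulg1.
pose fs := [seq f u | u <- enum {ffun K -> 'F_p}].
have [x xp xf] := infinite_set_notin fs H_inf.
have inf u : f u \in fs by apply: map_f; rewrite mem_enum.
have xD (a b : 'F_p) : x ^+ (a + b)%R = x ^+ a * x ^+ b.
  rewrite -expgnDr -[RHS]expg_modn //; congr (x ^+ _).
  exact: modn_Fp.
exists (fun u : {ffun K -> 'F_p} => x ^+ (u k) * f u).
  move=> u v; rewrite fD ffunE xD -!mulgA; congr (_ * _).
  by rewrite mulgA [x ^+ _ * f u]HC -mulgA.
move=> u xfu; have fX m : f (- u *+ m)%R = (x ^+ u k) ^+ m.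
  have f0 : f 0%R = 1 by apply: (mulgI (f 0%R)); rewrite -fD GRing.addr0 mulg1.
  elim: m => [|m IHm]; first by rewrite GRing.mulr0n f0.
  rewrite GRing.mulrS fD IHm expgS; congr (_ * _).
  by apply: (mulIg (f u)); rewrite -fD GRing.addNr f0 xfu.
have uk0 : u k = 0%R.
  apply/eqP; apply: contraNT xf => uk0.
  have : x ^+ (u k) ^+ ((u k)^-1 : 'F_p)%R = x.
    set w : 'F_p := (_^-1)%R; rewrite -expgnA -expg_modn //.
    have -> : (u k * w) %% p = (u k * w)%R.
      exact/esym/modn_Fp.
    rewrite GRing.mulfV //.
  by rewrite -fX => <-.
move=> j; rewrite inE => /predU1P[->//|]; apply: f1.
by move: xfu; rewrite uk0 mul1g.
Qed.

End Embedding.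

Lemma finite_torsion_elements (H : groupType) :
  (forall a b : H, commute a b) -> CI_group H ->
  finite_set (torsion_elements H p).
Proof.
move=> HC CIH; apply: contrapT => Hinf.
pose I := ('I_p.*2.-1 + {set 'I_p.*2.-1})%type.
have [f fD f_inj] := elementary_abelian_embed HC Hinf I.
pose j (v : pair_space) : {ffun I -> 'F_p} :=
  [ffun i => match i with inl i => v.1 i | inr K => v.2 K end].
have jD (u v : pair_space) : j (u + v)%R = (j u + j v)%R.
  by apply/ffunP => -[i|K]; rewrite !ffunE.
have j_inj : injective j.
  move=> [d b] [d' b'] /ffunP e.
  congr (_, _); apply/ffunP => i.
    by have := e (inl i); rewrite !ffunE.
  by have := e (inr i); rewrite !ffunE.
apply: pair_space_not_CI; apply: (CI_embed (f := f \o j) _ _ CIH).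
  by move=> u v /=; rewrite -fD -jD.
exact: inj_comp.
Qed.

End ElementaryAbelian.

(** An infinite CI-group would have a countable infinite abelian CI subgroup,
    which has infinite 2-torsion or infinite 3-torsion, and so contains the
    non-CI group [pair_space] for p = 2 or p = 3. *)
Theorem infinite_group_not_CI (G : groupType) :
  infinite_set [set: G] -> ~ CI_group G.
Proof.
move=> Ginf /(CI_countable_abelian Ginf)[H [e [esurj Hinf HC CIH]]].
by case: (CI_infinite_torsion esurj Hinf HC CIH); apply;
  apply: finite_torsion_elements.
Qed.

Theorem corollary2p8 :
  (forall (G : groupType) (P : pred G) (H : subGroupType P),
     CI_group G -> CI_group H) /\
  (forall G : groupType, infinite_group G -> CI_group G ->
     torsion_group G /\ ~ locally_finite G) /\
  ((exists G : groupType, infinite_group G /\ CI_group G) ->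
   exists G : groupType,
     [/\ infinite_group G, CI_group G & finitely_generated [set: G]%classic]).
Proof.
split; first exact: CI_subgroup.
split=> [G Ginf /(infinite_group_not_CI Ginf) //|[G [Ginf]]].
by move/(infinite_group_not_CI Ginf).
Qed.
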